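(* For every integer $\ell\ge 4$ there exist constants $c_\ell,C_\ell>0$ such that for all sufficiently large $n$, $$c_\ell\, n^{3/2}\le \mathrm{ex}(n,C_{2\ell}^{\square})\le C_\ell\, n^{3/2}.$$
   Context: $\mathrm{ex}(n,F)$ denotes the maximum number of edges in an $n$-vertex graph containing no subgraph isomorphic to $F$. The prism $C_{2\ell}^{\square}=C_{2\ell}\square K_2$ is the Cartesian product of the cycle $C_{2\ell}$ with an edge: it consists of two vertex-disjoint $2\ell$-cycles $a_1a_2\cdots a_{2\ell}a_1$ and $b_1b_2\cdots b_{2\ell}b_1$ together with the matching edges $a_ib_i$, $1\le i\le 2\ell$. *)

(* Defs.v *)
From mathcomp Require Import all_boot.
Set Implicit Arguments. Unset Strict Implicit. Unset Printing Implicit Defensive.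

Definition simple_graph (n : nat) (E : {set {set 'I_n}}) : bool :=
  [forall e in E, #|e| == 2].

Definition contains_copy (V : finType) (adjF : rel V) (n : nat)
    (E : {set {set 'I_n}}) : bool :=
  [exists f : {ffun V -> 'I_n},
     injectiveb f &&
     [forall u : V, forall v : V, adjF u v ==> ([set f u; f v] \in E)]].

Definition ex (V : finType) (adjF : rel V) (n : nat) : nat :=
  \max_(E : {set {set 'I_n}} | simple_graph E && ~~ contains_copy adjF E) #|E|.

(* The prism C_{2l} \square K_2: vertices (i, s) with i : 'I_(2l), s : bool
   (s = false : a_i, s = true : b_i); (i,s) ~ (j,t) iff either s = t and i, j are
   consecutive on the cycle Z_{2l}, or i = j and s <> t. *)
Definition prism_adj (l : nat) : rel ('I_(2 * l) * bool) :=
  fun x y =>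
    ((x.2 == y.2) &&
      ((x.1.+1 %% (2 * l) == y.1) || (y.1.+1 %% (2 * l) == x.1)))
    || ((x.1 == y.1) && (x.2 != y.2)).

(* Main.v *)
(** Upper bound. The prism is a cyclic strip: vertices [u_i], [v_i] ([i] modulo [2 l]) with
    [u_i] adjacent to [v_(i-1)], [v_i], [v_(i+1)].  Pass to a bipartite subgraph in which every
    vertex of the side [B] has exactly [d] neighbours in the side [A].  A strip is a closed
    walk of length [2 l] without repeated [u] or [v] in the graph whose vertices are the edges
    [(x, c)] and whose edges are the 4-cycles [x c w z].  Weighting such a 4-cycle by the inverse
    of the codegree of [x] and [w] gives a symmetric matrix [M] with row sums at most [d] and
    average row sum of order [d], so the trace of [M^(2 l)] is at least of order [d^(2 l)].
    The weight of the closed walks that repeat a [u] (or a [v]) is bounded by log-convexity of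
    traces: it is small against the trace of [M^(2 l)] as soon as the trace of [D^l] is, where
    [D] is the part of [M^2] that joins states with the same label.  For [u] this follows from
    the row sums.  For [v] it follows from a peeling argument: if two vertices [c], [z] have many
    cherries inside their common neighbourhood, a greedily built ladder there closes up through
    [c] and [z] to a strip.  The same peeling argument shows that 4-cycles with an
    exceptionally large codegree on the side [B] carry little weight and may be discarded.
    For [l >= 4] all error terms are at most a constant times [#|B| d^(2 l - 2)].

    Lower bound. The prism contains a 4-cycle, and the point-line incidence graph of an affine
    plane over a field with [2^j] elements does not. *)
Require Import Defs.
From mathcomp Require Import all_boot all_order all_algebra all_field.
From mathcomp Require Import ring lra zify.
From Stdlib Require Reals Lra.
Set Implicit Arguments. Unset Strict Implicit. Unset Printing Implicit Defensive.
Import Order.TTheory GRing.Theory Num.Theory.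

(** * Sequences, closed walks and traces *)

Open Scope ring_scope.

(** * Cauchy-Schwarz and log-convex sequences *)

Section RealSequences.
Variable F : realFieldType.

(** Lagrange's identity: the squares [(x i * y j - x j * y i) ^+ 2] add up to twice the gap between
    the two sides. *)
Lemma cauchy_schwarz_sum (I : finType) (x y : I -> F) :
  (\sum_i x i * y i) ^+ 2 <= (\sum_i x i ^+ 2) * (\sum_i y i ^+ 2).
Proof.
have h : 0 <= \sum_i \sum_j (x i * y j - x j * y i) ^+ 2.
  by apply: sumr_ge0 => i _; apply: sumr_ge0 => j _; apply: sqr_ge0.
suff e : \sum_i \sum_j (x i * y j - x j * y i) ^+ 2 =
  2 * ((\sum_i x i ^+ 2) * (\sum_i y i ^+ 2) - (\sum_i x i * y i) ^+ 2).
  by rewrite e in h; lra.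
transitivity (\sum_i \sum_j (x i ^+ 2 * y j ^+ 2)
   + \sum_i \sum_j (x j ^+ 2 * y i ^+ 2)
   - 2 * \sum_i \sum_j (x i * y i) * (x j * y j)).
  rewrite mulr_sumr -big_split -sumrB; apply: eq_bigr => i _ /=.
  rewrite mulr_sumr -big_split -sumrB; apply: eq_bigr => j _ /=; ring.
rewrite [\sum_i \sum_j x j ^+ 2 * y i ^+ 2]exchange_big /=.
have -> (a b : I -> F) : \sum_i \sum_j a i * b j = (\sum_i a i) * (\sum_j b j).
  by rewrite mulr_suml; apply: eq_bigr => i _; rewrite mulr_sumr.
have -> (a b : I -> F) : \sum_i \sum_j a i * b j = (\sum_i a i) * (\sum_j b j).
  by rewrite mulr_suml; apply: eq_bigr => i _; rewrite mulr_sumr.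
by ring.
Qed.

(** Log-convexity makes the ratios [h i.+1 / h i] nondecreasing, so a first ratio above [e] would
    push [h k] above [e ^+ k * h 0]. *)
Lemma logconvex_le_geom (h : nat -> F) (k : nat) (e : F) :
    (0 < k)%N -> 0 < e -> 0 < h 0%N ->
    (forall i, (i.+2 <= k)%N -> h i.+1 ^+ 2 <= h i * h i.+2) ->
  h k <= e ^+ k * h 0%N -> h 1%N <= e * h 0%N.
Proof.
move=> k0 e0 h0 conv hk; rewrite leNgt; apply/negP => h1.
have step i : (i < k)%N -> 0 < h i /\ e * h i < h i.+1.
  elim: i => [//|i IH] ik; have [hi hi1] := IH (ltnW ik).
  have p1 : 0 < h i.+1 by apply: lt_trans hi1; rewrite mulr_gt0.
  split=> //; have c := conv i ik.
  rewrite -(ltr_pM2l hi); apply: lt_le_trans c.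
  by rewrite expr2 mulrA [_ * e]mulrC ltr_pM2r.
suff main i : (i < k)%N -> e ^+ i.+1 * h 0%N < h i.+1.
  by have := main k.-1; rewrite prednK // => /(_ (leqnn _)); rewrite ltNge hk.
elim: i => [|i IH] ik; first by rewrite expr1.
have [_] := step _ ik; apply: lt_trans.
by rewrite exprS -mulrA ltr_pM2l // IH // ltnW.
Qed.

(** At the least index where [g] exceeds [g 1] the sequence has just risen. Log-convexity makes it
    go on rising up to [k - 1], where symmetry returns the value [g 1]. The ends [0] and [k] are
    left out because [g 0] may be larger. *)
Lemma logconvex_sym_le (g : nat -> F) (k : nat) :
    (forall i, (i <= k)%N -> 0 <= g i) ->
    (forall i, (i <= k)%N -> g (k - i)%N = g i) ->
    (forall i, (i.+2 <= k)%N -> g i.+1 ^+ 2 <= g i * g i.+2) ->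
  forall i, (0 < i < k)%N -> g i <= g 1%N.
Proof.
move=> g0 gs conv i /andP[i0 ik]; rewrite leNgt; apply/negP => gi.
have exP : exists j, (0 < j < k)%N && (g 1%N < g j) by exists i; rewrite i0 ik.
have [j /andP[/andP[j0 jk] gj] jmin] := ex_minnP exP.
case: j j0 jk gj jmin => // -[|j] _ jk gj jmin; first by rewrite ltxx in gj.
have gj1 : g j.+1 <= g 1%N.
  rewrite leNgt; apply/negP => bad.
  by have := jmin j.+1; rewrite bad (ltnW jk) ltnn => /(_ isT).
have step l : (j < l)%N -> (l.+1 < k)%N -> 0 < g l /\ g l < g l.+1.
  elim: l => [//|l IH] jl lk; have [ejl|jl'] := eqVneq l j.
    rewrite ejl; split; last exact: le_lt_trans gj.
    rewrite lt_def g0 ?andbT; last by lia.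
    (* If [g j.+1] vanished, log-convexity one place further would make [g j.+2] vanish too,
       although it exceeds [g 1]. *)
    apply/eqP => z; have := conv j.+1 jk; rewrite z mul0r => c.
    have g2 : 0 < g j.+2 by apply: le_lt_trans gj; apply: g0; lia.
    by have := exprn_gt0 2 g2; rewrite ltNge c.
  have [||p q] := IH; [by lia|by lia|].
  have q1 : 0 < g l.+1 by apply: lt_trans q.
  split=> //; have c := conv l (ltnW lk).
  rewrite -(ltr_pM2l p); apply: lt_le_trans c.
  by rewrite expr2 ltr_pM2r.
have gk : g (k - 1)%N = g 1%N by apply: gs; lia.
have up l : (j.+1 < l < k)%N -> g 1%N < g l.
  elim: l => [//|l IH] /andP[jl lk]; have [ejl|jl'] := eqVneq l j.+1.
    by rewrite ejl.
  have [||_ q] := step l; [by lia|by lia|].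
  by apply: lt_trans q; apply: IH; lia.
by have := up (k - 1)%N; rewrite gk ltxx => /(_ ltac:(lia)).
Qed.

End RealSequences.

Lemma logconvex_ge_geom (F : realFieldType) (h : nat -> F) (k : nat) (e : F) :
    0 < e -> 0 < h 0%N -> (forall i, (i.+2 <= k)%N -> h i.+1 ^+ 2 <= h i * h i.+2) ->
  e * h 0%N <= h 1%N -> (0 < k)%N -> e ^+ k * h 0%N <= h k.
Proof.
move=> e0 h0 conv h1 k0.
have step i : (i < k)%N -> 0 < h i /\ e * h i <= h i.+1.
  elim: i => [//|i IH] ik; have [hi hi1] := IH (ltnW ik).
  have p1 : 0 < h i.+1 by apply: lt_le_trans hi1; rewrite mulr_gt0.
  split=> //; have c := conv i ik.
  rewrite -(ler_pM2l hi); apply: le_trans c.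
  by rewrite expr2 mulrA [_ * e]mulrC ler_pM2r.
suff main i : (i < k)%N -> e ^+ i.+1 * h 0%N <= h i.+1.
  by have := main k.-1; rewrite prednK // => /(_ (leqnn _)).
elim: i => [|i IH] ik; first by rewrite expr1.
have [_] := step _ ik; apply: le_trans.
by rewrite exprS -mulrA ler_pM2l // IH // ltnW.
Qed.

(** * Closed walks and traces of matrix products *)

Section ClosedWalks.
Variables (F : realFieldType) (n : nat).
Implicit Types (N : nat -> 'M[F]_n) (M : 'M[F]_n).

Fixpoint walk_weight N (x : 'I_n) (s : seq 'I_n) : F :=
  if s is y :: s' then N 0%N x y * walk_weight (fun i => N i.+1) y s' else 1.

Lemma sum_walk_weight N m x y :
  \sum_(t : m.-tuple 'I_n) walk_weight N x t * (last x t == y)%:R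
    = (\prod_(i < m) N i) x y.
Proof.
elim: m N x => [|m IH] N x.
  rewrite big_ord0 (big_pred1 [tuple]) => [|t]; last by rewrite [t]tuple0; apply/esym/eqP.
  by rewrite /= mul1r mxE.
rewrite big_ord_recl mxE.
rewrite (reindex (fun p : 'I_n * m.-tuple 'I_n => [tuple of p.1 :: p.2])) /=; last first.
  exists (fun t : m.+1.-tuple 'I_n => (thead t, [tuple of behead t])) => [[z t] _|t _].
    by congr pair; apply: val_inj.
  by rewrite -tuple_eta.
rewrite -(pair_big xpredT xpredT (fun z (t : m.-tuple 'I_n) =>
  N 0%N x z * walk_weight (fun i => N i.+1) z t * (last z t == y)%:R)) /=.
apply: eq_bigr => z _.
rewrite -(IH (fun i => N i.+1)) mulr_sumr.
by apply: eq_bigr => t _; rewrite mulrA.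
Qed.

Lemma walk_weight_ge0 N x s : (forall i x y, 0 <= N i x y) -> 0 <= walk_weight N x s.
Proof.
by elim: s N x => [|y s IH] N x N0 //=; rewrite mulr_ge0 // IH.
Qed.

Lemma walk_weight_neq0 N x s i : (i < size s)%N -> walk_weight N x s != 0 ->
  N i (nth x (x :: s) i) (nth x (x :: s) i.+1) != 0.
Proof.
elim: s N x i => [//|y s IH] N x [_|i is_] /=; rewrite mulf_eq0 negb_or => /andP[h1 h2] //.
have := IH _ y i is_ h2; rewrite /= (set_nth_default x) //.
rewrite [X in N _ _ X](set_nth_default x) //=.
by move: is_; rewrite ltnS => /ltnW.
Qed.

Definition closed_sum N m (p : 'I_n -> m.-tuple 'I_n -> bool) : F :=
  \sum_x \sum_(t : m.-tuple 'I_n | (last x t == x) && p x t) walk_weight N x t.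

Lemma closed_sumT N m : closed_sum N (fun _ (_ : m.-tuple 'I_n) => true)
  = \tr (\prod_(i < m) N i).
Proof.
apply: eq_bigr => x _; rewrite -sum_walk_weight big_mkcond /=; apply: eq_bigr => t _.
by rewrite andbT; case: eqP => _; rewrite ?mulr1 ?mulr0.
Qed.

End ClosedWalks.

(** * The trace inner product *)

Section TraceInequalities.
Variables (F : realFieldType) (n : nat).
Implicit Types (A B X Y M : 'M[F]_n).

Lemma mxtrace_rmulC A B : \tr (A * B) = \tr (B * A).
Proof. exact: (mxtrace_mulC A B). Qed.

Lemma trmx_rmul A B : (A * B)^T = B^T * A^T.
Proof. exact: (trmx_mul A B). Qed.

Lemma trmx_exp M i : M^T = M -> (M ^+ i)^T = M ^+ i.
Proof.
move=> sM; elim: i => [|i IH].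
  exact: (tr_scalar_mx n (1 : F)).
by rewrite exprSr trmx_rmul IH sM -exprS exprSr.
Qed.

Lemma frobenius_ge0 X : 0 <= \tr (X^T * X).
Proof.
apply: sumr_ge0 => i _; rewrite mxE; apply: sumr_ge0 => j _.
by rewrite mxE -expr2 sqr_ge0.
Qed.

(** Cauchy-Schwarz over all entries of all members of the two families; the index [K] lets one
    inequality cover a sum over all labels. *)
Lemma frobenius_cauchy_schwarz (K : finType) (X Y : K -> 'M[F]_n) :
  (\sum_c \tr ((X c)^T * Y c)) ^+ 2
    <= (\sum_c \tr ((X c)^T * X c)) * (\sum_c \tr ((Y c)^T * Y c)).
Proof.
have e (U V : K -> 'M[F]_n) : \sum_c \tr ((U c)^T * V c) =
    \sum_(p : K * ('I_n * 'I_n)) U p.1 p.2.2 p.2.1 * V p.1 p.2.2 p.2.1.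
  rewrite -(pair_big xpredT xpredT (fun c (q : 'I_n * 'I_n) => U c q.2 q.1 * V c q.2 q.1)) /=.
  apply: eq_bigr => c _.
  rewrite -(pair_big xpredT xpredT (fun i j => U c j i * V c j i)) /=.
  by apply: eq_bigr => i _; rewrite mxE; apply: eq_bigr => j _; rewrite mxE.
rewrite !e.
have -> (U : K -> 'M[F]_n) : \sum_(p : K * ('I_n * 'I_n)) U p.1 p.2.2 p.2.1 * U p.1 p.2.2 p.2.1
   = \sum_(p : K * ('I_n * 'I_n)) (U p.1 p.2.2 p.2.1) ^+ 2.
  by apply: eq_bigr => p _; rewrite expr2.
have -> (U : K -> 'M[F]_n) : \sum_(p : K * ('I_n * 'I_n)) U p.1 p.2.2 p.2.1 * U p.1 p.2.2 p.2.1
   = \sum_(p : K * ('I_n * 'I_n)) (U p.1 p.2.2 p.2.1) ^+ 2.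
  by apply: eq_bigr => p _; rewrite expr2.
exact: cauchy_schwarz_sum.
Qed.

End TraceInequalities.

(** * Closed walks that repeat a label *)

Section Labels.
Variables (F : realFieldType) (n : nat) (K : finType) (phi : 'I_n -> K).
Variables (M : 'M[F]_n) (k : nat).
Hypothesis symM : M^T = M.
Hypothesis M_proper : forall x y, phi x = phi y -> M x y = 0.
Hypothesis k_ge2 : (2 <= k)%N.

(** The coordinate projection onto the states with label [c]. *)
Let P (c : K) : 'M[F]_n := diag_mx (\row_i (phi i == c)%:R).

Let PE c A x y : (P c * A) x y = (phi x == c)%:R * A x y.
Proof. by rewrite (mul_diag_mx _ A : P c * A = _) !mxE. Qed.

Let EP c A x y : (A * P c) x y = A x y * (phi y == c)%:R.
Proof. by rewrite (mul_mx_diag A _ : A * P c = _) !mxE. Qed.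

Let symP c : (P c)^T = P c.
Proof. exact: tr_diag_mx. Qed.

(* The weight of the closed walks of length [2 k] with equal labels at two given positions at
   distance [j]; see [closed_sum_collision]. *)
Definition collision (j : nat) : F :=
  \sum_c \tr (P c * M ^+ j * P c * M ^+ (2 * k - j)).

Lemma collision_sym j : (j <= 2 * k)%N -> collision (2 * k - j) = collision j.
Proof.
move=> jk; apply: eq_bigr => c _; rewrite subKn //.
by rewrite -!mulrA mxtrace_rmulC -!mulrA mxtrace_rmulC -!mulrA mxtrace_rmulC !mulrA.
Qed.

(** A Gram form: it turns Cauchy-Schwarz into log-convexity of [collision] along the even
    distances. *)
Lemma collision_ip i j : (i <= k)%N -> (j <= k)%N ->
  \sum_c \tr ((M ^+ i * P c * M ^+ (k - i))^T * (M ^+ j * P c * M ^+ (k - j)))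
    = collision (i + j).
Proof.
move=> ik jk; apply: eq_bigr => c _.
rewrite !trmx_rmul !trmx_exp // symP -!mulrA mxtrace_rmulC.
rewrite !mulrA -(mulrA (P c) (M ^+ i)) -exprD -(mulrA _ (M ^+ (k - j))) -exprD.
by congr (\tr (_ * M ^+ _)); lia.
Qed.

Lemma collision_conv i j : (i <= k)%N -> (j <= k)%N ->
  collision (i + j) ^+ 2 <= collision (i + i) * collision (j + j).
Proof.
by move=> ik jk; rewrite -!collision_ip //; apply: frobenius_cauchy_schwarz.
Qed.

Lemma collision_ge0 i : (i <= k)%N -> 0 <= collision (i + i).
Proof.
by move=> ik; rewrite -collision_ip // sumr_ge0 // => c _; apply: frobenius_ge0.
Qed.

Lemma collision_even i : (0 < i < k)%N -> collision (i + i) <= collision 2.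
Proof.
apply: (@logconvex_sym_le _ (fun i => collision (i + i)) k) => j jk.
- exact: collision_ge0.
- rewrite -collision_sym; last by lia.
  by congr collision; lia.
- by have := @collision_conv j j.+2; rewrite !addSn !addnS; apply; lia.
Qed.

Lemma collision1 : collision 1 = 0.
Proof.
rewrite /collision big1 // => c _; rewrite expr1.
suff -> : P c * M * P c = 0 by rewrite mul0r mxtrace0.
apply/matrixP => x y; rewrite EP PE mxE.
case: (eqVneq (phi x)) => [ex|_]; last by rewrite !mul0r.
case: (eqVneq (phi y)) => [ey|_]; last by rewrite mulr0.
by rewrite M_proper ?mul1r ?mul0r // ex ey.
Qed.

(** Even distances are covered by symmetry and log-convexity. An odd distance is bounded by the
    geometric mean of its two even neighbours. For [1] and [2 * k - 1] one neighbour would be the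
    unbounded [collision 0], but these two vanish because [M] never joins equal labels. *)
Lemma collision_le j : (0 < j < 2 * k)%N -> collision j <= collision 2.
Proof.
have c2 : 0 <= collision 2 by apply: (@collision_ge0 1); lia.
move=> jk; have [->|j1] := eqVneq j 1%N; first by rewrite collision1.
have [->|jk1] := eqVneq j (2 * k - 1)%N; first by rewrite collision_sym ?collision1; last by lia.
have je := odd_double_half j; set i := j./2 in je.
have [oj|ej] := boolP (odd j); last first.
  rewrite (negbTE ej) add0n -addnn in je; rewrite -je; apply: collision_even; lia.
rewrite oj -addnn in je.
have := @collision_conv i i.+1; rewrite (_ : (i + i.+1 = j)%N); last by lia.
move=> /(_ ltac:(lia) ltac:(lia)) c.
have h1 : collision (i + i) <= collision 2 by apply: collision_even; lia.
have h2 : collision (i.+1 + i.+1) <= collision 2 by apply: collision_even; lia.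
rewrite leNgt; apply/negP => bad.
have : collision 2 * collision 2 < collision j ^+ 2 by rewrite expr2 ltr_pM.
rewrite ltNge => /negP; apply; apply: le_trans c _.
by apply: ler_pM => //; apply: collision_ge0; lia.
Qed.

Definition label_square : 'M[F]_n := \matrix_(x, y) ((phi x == phi y)%:R * (M ^+ 2) x y).
Local Notation D := label_square.

Let DE : D = \sum_c P c * M ^+ 2 * P c.
Proof.
apply/matrixP => x y; rewrite summxE mxE (bigD1 (phi x)) //= big1 ?addr0.
  by rewrite EP PE eqxx mul1r mulrC eq_sym.
by move=> c nc; rewrite EP PE eq_sym (negbTE nc) !mul0r.
Qed.

Let symD : D^T = D.
Proof.
rewrite DE raddf_sum; apply: eq_bigr => c _ /=.
by rewrite expr2 !trmx_rmul symP symM !mulrA.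
Qed.

(** Interpolates from the full trace at [0], through [collision 2] at [1], to [\tr (D ^+ k)] at
    [k]. *)
Let h i := \tr (D ^+ i * M ^+ (2 * (k - i))).

Let h_ip a b u v : \tr ((D ^+ a * M ^+ u)^T * (D ^+ b * M ^+ v)) = \tr (D ^+ (a + b) * M ^+ (u + v)).
Proof.
rewrite trmx_rmul !trmx_exp // -!mulrA mxtrace_rmulC -!mulrA -exprD.
by rewrite mulrA -exprD [(v + u)%N]addnC.
Qed.

(** The Gram form for odd powers of [D]: since [D] is the sum of the matrices
    [(M * P c)^T * (M * P c)], summing over [c] supplies the odd factor. *)
Let h_ipP a b u v :
  \sum_c \tr ((M * P c * D ^+ a * M ^+ u)^T * (M * P c * D ^+ b * M ^+ v))
   = \tr (D ^+ (a + b).+1 * M ^+ (u + v)).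
Proof.
rewrite (eq_bigr (fun c => \tr (D ^+ a * (P c * M ^+ 2 * P c) * (D ^+ b * M ^+ (v + u))))).
  by rewrite -raddf_sum -mulr_suml -mulr_sumr -DE -exprSr mulrA -exprD addSn [(v + u)%N]addnC.
move=> c _; rewrite expr2 exprD !trmx_rmul !trmx_exp // symP symM.
by rewrite -!mulrA mxtrace_rmulC !mulrA.
Qed.

(** The sequence [h] is log-convex, so [logconvex_le_geom] carries smallness at its far end
    [\tr (D ^+ k)] back to its first step. *)
Lemma collision2_le (e : F) : 0 < e -> 0 < \tr (M ^+ (2 * k)) ->
  \tr (D ^+ k) <= e ^+ k * \tr (M ^+ (2 * k)) -> collision 2 <= e * \tr (M ^+ (2 * k)).
Proof.
move=> e0 tr0 hk.
have h0 : h 0 = \tr (M ^+ (2 * k)) by rewrite /h expr0 mul1r subn0.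
have <- : h 1 = collision 2.
  rewrite /h /collision DE expr1 mulr_suml raddf_sum; apply: eq_bigr => c _.
  by rewrite mulnBr muln1.
rewrite -h0; apply: (@logconvex_le_geom _ h k) => //; first by lia.
- by rewrite h0.
- move=> i ik; set j := (k - i.+1)%N.
  have e1 : (2 * (k - i.+1) = j.+1 + j.-1)%N by lia.
  have e2 : (2 * (k - i) = j.+1 + j.+1)%N by lia.
  have e3 : (2 * (k - i.+2) = j.-1 + j.-1)%N by lia.
  rewrite /h e1 e2 e3.
  have ie := odd_double_half i; set a := i./2 in ie.
  (* The parity of [i] decides which Gram form applies. In both, the powers [j.+1] and [j.-1] of [M]
     belong to the two outer terms, and their mixed product is the middle term. *)
  have [oi|ei] := boolP (odd i).
    have -> : i = (a + a).+1 by lia.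
    have -> : (a + a).+2 = (a + a.+1).+1 by lia.
    have -> : (a + a.+1).+2 = (a.+1 + a.+1).+1 by lia.
    by rewrite -!h_ipP; apply: frobenius_cauchy_schwarz.
  have -> : i = (a + a)%N by lia.
  have -> : (a + a).+1 = (a + a.+1)%N by lia.
  have -> : (a + a.+1).+1 = (a.+1 + a.+1)%N by lia.
  rewrite -!h_ip.
  by have := frobenius_cauchy_schwarz (fun _ : unit => D ^+ a * M ^+ j.+1) (fun=> D ^+ a.+1 * M ^+ j.-1); rewrite !big_const !card_unit /= !addr0.
- by rewrite h0 /h subnn muln0 expr0 mulr1.
Qed.

Lemma prod_marked c i j m : (i < j < m)%N ->
  \prod_(l < m) (if (l == i :> nat) || (l == j :> nat) then P c * M else M)
    = M ^+ i * P c * M ^+ (j - i) * P c * M ^+ (m - j).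
Proof.
move=> /andP[ij jm].
rewrite -(big_mkord xpredT (fun l => if (l == i) || (l == j) then P c * M else M)).
rewrite (@big_cat_nat _ _ _ i) //=; last by lia.
rewrite (@big_cat_nat _ _ _ j i m) //=; [|by lia|by lia].
rewrite (big_ltn ij) (big_ltn jm) /= !eqxx /= orbT.
have gen a b : (forall l, (a <= l < b)%N -> (l == i) || (l == j) = false) ->
    \prod_(a <= l < b) (if (l == i) || (l == j) then P c * M else M) = M ^+ (b - a).
  move=> hl; rewrite -prodr_const_nat; apply: eq_big_nat => l lab; by rewrite hl.
rewrite !gen; last first.
- by move=> l ?; lia.
- by move=> l ?; lia.
- by move=> l ?; lia.
rewrite subn0 -!mulrA; congr (_ * (_ * _)).
rewrite !mulrA -exprS -!mulrA -exprS.
by rewrite subnSK // subnSK.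
Qed.

Lemma walk_weight_proj c (a : pred nat) x s :
  walk_weight (fun l => if a l then P c * M else M) x s =
   (all (fun l => a l ==> (phi (nth x (x :: s) l) == c)) (iota 0 (size s)))%:R
     * walk_weight (fun=> M) x s.
Proof.
elim: s x a => [|z s IH] x a /=; first by rewrite mulr1.
rewrite (IH z (fun l => a l.+1)) -(addn0 1%N) iotaDl all_map.
rewrite (eq_in_all (a2 := preim (addn 1) (fun l => a l ==> (phi (nth x [:: x, z & s] l) == c)))).
  case: (a 0%N) => /=; last by rewrite mulrCA.
  by rewrite PE; case: (phi x == c) => /=; rewrite ?mul1r ?mul0r // mulrCA.
move=> l; rewrite mem_iota add0n /= => ls; rewrite add1n /=.
by rewrite (set_nth_default x) //= ltnS ltnW.
Qed.

(** Equality of the labels at two times is split by the common value [c], which becomes a projection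
    [P c] at each of the two times; cyclicity of the trace then moves the first one to the front. *)
Lemma closed_sum_collision (i j m : nat) : (i < j < m)%N -> m = (2 * k)%N ->
  closed_sum (fun=> M) (fun x (t : m.-tuple 'I_n) =>
     phi (nth x (x :: t) i) == phi (nth x (x :: t) j)) = collision (j - i).
Proof.
move=> ijm mk; have /andP[ij jm] := ijm.
transitivity (\sum_c \tr (\prod_(l < m) (if (l == i :> nat) || (l == j :> nat) then P c * M else M))).
  transitivity (\sum_c closed_sum (fun l => if (l == i) || (l == j) then P c * M else M)
      (fun _ (_ : m.-tuple 'I_n) => true)); last first.
    by apply: eq_bigr => c _; rewrite closed_sumT.
  rewrite /closed_sum exchange_big /=; apply: eq_bigr => x _.
  rewrite exchange_big /= big_mkcondr /=; apply: eq_big => [t|t _]; first by rewrite andbT.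
  have w c : walk_weight (fun l => if (l == i) || (l == j) then P c * M else M) x t =
     ((phi (nth x (x :: t) i) == c) && (phi (nth x (x :: t) j) == c))%:R * walk_weight (fun=> M) x t.
    rewrite (walk_weight_proj c (fun l => (l == i) || (l == j))).
    congr (_%:R * _); congr nat_of_bool; rewrite size_tuple; apply/allP/andP.
      move=> hall; split.
        by have := hall i; rewrite mem_iota eqxx => /(_ ltac:(lia)).
      by have := hall j; rewrite mem_iota eqxx orbT => /(_ ltac:(lia)).
    by move=> [hi hj] l _; apply/implyP => /orP[/eqP->|/eqP->].
  rewrite (eq_bigr _ (fun c _ => w c)) -mulr_suml.
  rewrite (bigD1 (phi (nth x (x :: t) i))) //= big1 ?addr0.
    by rewrite eqxx /= eq_sym; case: eqP; rewrite ?mul1r ?mul0r.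
  by move=> c nc; rewrite eq_sym (negbTE nc).
apply: eq_bigr => c _; rewrite prod_marked //.
rewrite -!mulrA mxtrace_rmulC -!mulrA -exprD.
by congr (\tr (_ * (_ * (_ * _ ^+ _)))); lia.
Qed.

Theorem closed_sum_collision_le (i j m : nat) (e : F) : (i < j < m)%N -> m = (2 * k)%N ->
    0 < e -> 0 < \tr (M ^+ m) -> \tr (D ^+ k) <= e ^+ k * \tr (M ^+ m) ->
  closed_sum (fun=> M) (fun x (t : m.-tuple 'I_n) =>
     phi (nth x (x :: t) i) == phi (nth x (x :: t) j)) <= e * \tr (M ^+ m).
Proof.
move=> ijm mk e0 tr0 hD; rewrite closed_sum_collision //.
apply: (@le_trans _ _ (collision 2)); first by apply: collision_le; lia.
by rewrite mk in tr0 hD *; apply: collision2_le.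
Qed.

End Labels.

(** * Bounds for traces of powers *)

Section TraceBounds.
Variables (F : realFieldType) (n : nat).
Implicit Types M D : 'M[F]_n.

Lemma mxpow_ge0 M i x y : (forall x y, 0 <= M x y) -> 0 <= (M ^+ i) x y.
Proof.
move=> M0; elim: i x y => [|i IH] x y; first by rewrite expr0 mxE ler0n.
by rewrite exprS mxE sumr_ge0 // => z _; rewrite mulr_ge0.
Qed.

Lemma mxpow_row_le M i (r : F) x : 0 <= r -> (forall x y, 0 <= M x y) ->
  (forall x, \sum_y M x y <= r) -> \sum_y (M ^+ i) x y <= r ^+ i.
Proof.
move=> r0 M0 Mr; elim: i x => [|i IH] x.
  rewrite expr0 (bigD1 x) //= big1 => [|y yx]; rewrite mxE ?eqxx ?addr0 //.
  by rewrite eq_sym (negbTE yx).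
rewrite exprS (eq_bigr (fun y => \sum_z M x z * (M ^+ i) z y)); last first.
  by move=> y _; rewrite mxE.
rewrite exchange_big /=; apply: (@le_trans _ _ (\sum_z M x z * r ^+ i)).
  by apply: ler_sum => z _; rewrite -mulr_sumr ler_wpM2l.
by rewrite -mulr_suml exprS ler_wpM2r // exprn_ge0.
Qed.

Lemma mxpow_trace_le_card D k (r : F) : 0 <= r -> (forall x y, 0 <= D x y) ->
  (forall x, \sum_y D x y <= r) -> \tr (D ^+ k) <= n%:R * r ^+ k.
Proof.
move=> r0 D0 Dr; rewrite mulr_natl -[n in X in _ <= X]card_ord -sumr_const.
apply: ler_sum => x _; apply: le_trans (mxpow_row_le k x r0 D0 Dr).
by rewrite (bigD1 x) //= lerDl sumr_ge0 // => y _; apply: mxpow_ge0.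
Qed.

(** Two factors [D] are spent on the sum of squares of the entries: [(D ^+ 2) x y] is at most the
    mean of the square sums of rows [x] and [y]. The other [k] factors are bounded by row sums. *)
Lemma mxpow_trace_le D k (r : F) : D^T = D -> 0 <= r -> (forall x y, 0 <= D x y) ->
  (forall x, \sum_y D x y <= r) -> \tr (D ^+ k.+2) <= r ^+ k * \sum_x \sum_y D x y ^+ 2.
Proof.
move=> sD r0 D0 Dr.
have Dsym x y : D x y = D y x by rewrite -{1}sD mxE.
pose q x := \sum_y D x y ^+ 2.
have D2 x y : (D ^+ 2) x y <= (q x + q y) / 2.
  rewrite expr2 mxE ler_pdivlMr // mulr_suml /q -big_split /=.
  by apply: ler_sum => z _; rewrite (Dsym z y); have := sqr_ge0 (D x z - D y z); lra.
have symk : (D ^+ k)^T = D ^+ k by apply: trmx_exp.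
have -> : k.+2 = (k + 2)%N by lia.
rewrite exprD; apply: (@le_trans _ _ (\sum_x \sum_y (D ^+ k) x y * ((q x + q y) / 2))).
  apply: ler_sum => x _; rewrite mxE; apply: ler_sum => y _.
  by rewrite ler_wpM2l ?mxpow_ge0 // addrC.
have e : \sum_x \sum_y (D ^+ k) x y * ((q x + q y) / 2) = \sum_x q x * \sum_y (D ^+ k) x y.
  transitivity ((\sum_x \sum_y (D ^+ k) x y * q x + \sum_x \sum_y (D ^+ k) x y * q y) / 2).
    rewrite -big_split mulr_suml; apply: eq_bigr => x _ /=.
    rewrite -big_split mulr_suml; apply: eq_bigr => y _ /=; lra.
  have -> : \sum_x \sum_y (D ^+ k) x y * q y = \sum_x \sum_y (D ^+ k) x y * q x.
    rewrite exchange_big; apply: eq_bigr => x _; apply: eq_bigr => y _.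
    by rewrite -{1}symk mxE.
  transitivity (\sum_x \sum_y (D ^+ k) x y * q x); first by lra.
  by apply: eq_bigr => x _; rewrite mulr_sumr; apply: eq_bigr => y _; rewrite mulrC.
rewrite e mulr_sumr; apply: ler_sum => x _; rewrite mulrC ler_wpM2r //.
  by apply: sumr_ge0 => y _; apply: sqr_ge0.
exact: mxpow_row_le.
Qed.

(** Let [W i] be the sum of all entries of [M ^+ i]. Log-convexity along even indices gives a lower
    bound for [W (2 k)], and the inequality between arithmetic and geometric means gives
    [W (2 k) <= n * \tr (M ^+ (2 * k))]. No eigenvalues are involved. *)
Lemma mxpow_trace_ge M k : M^T = M -> (0 < k)%N -> (0 < n)%N ->
  0 < \sum_x \sum_y M x y ->
  ((\sum_x \sum_y M x y) / n%:R) ^+ (2 * k) <= \tr (M ^+ (2 * k)).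
Proof.
move=> sM k0 n0; set w := \sum_x \sum_y M x y => w0.
have nF : 0 < n%:R :> F by rewrite ltr0n.
pose r i x := \sum_y (M ^+ i) x y.
pose W i := \sum_x \sum_y (M ^+ i) x y.
have symi i : (M ^+ i)^T = M ^+ i by apply: trmx_exp.
have WE i j : W (i + j)%N = \sum_x r i x * r j x.
  transitivity (\sum_z \sum_x \sum_y (M ^+ i) z x * (M ^+ j) z y); last first.
    by apply: eq_bigr => z _; rewrite mulr_suml; apply: eq_bigr => x _; rewrite mulr_sumr.
  rewrite exchange_big; apply: eq_bigr => x _; rewrite exchange_big.
  apply: eq_bigr => y _; rewrite exprD mxE; apply: eq_bigr => z _.
  by rewrite -{1}symi mxE.
have CS i j : W (i + j)%N ^+ 2 <= W (i + i)%N * W (j + j)%N.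
  rewrite !WE; exact: (cauchy_schwarz_sum (r i) (r j)).
have W0 : W 0%N = n%:R.
  rewrite /W (eq_bigr (fun=> 1)); first by rewrite sumr_const card_ord.
  move=> x _; rewrite (bigD1 x) //= big1 => [|y yx]; rewrite mxE ?eqxx ?addr0 //.
  by rewrite eq_sym (negbTE yx).
have W1 : W 1%N = w by [].
have low : ((w / n%:R) ^+ 2) ^+ k * W 0%N <= W (k + k)%N.
  apply: (@logconvex_ge_geom _ (fun i => W (i + i)%N) k) => //.
  - by rewrite exprn_gt0 // divr_gt0.
  - by rewrite W0.
  - by move=> i ik; have := CS i i.+2; rewrite !addSn !addnS.
  - rewrite W0; have := CS 0%N 1%N; rewrite W1 W0 => c.
    rewrite -(ler_pM2l nF); apply: le_trans c; rewrite le_eqVlt; apply/orP; left; apply/eqP.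
    by field; rewrite pnatr_eq0; lia.
have up : W (k + k)%N <= n%:R * \tr (M ^+ (2 * k)).
  pose q x := \sum_z (M ^+ k) x z ^+ 2.
  have trE : \tr (M ^+ (2 * k)) = \sum_x q x.
    apply: eq_bigr => x _; rewrite mul2n -addnn exprD mxE; apply: eq_bigr => z _.
    by rewrite expr2 -{2}symi mxE.
  apply: (@le_trans _ _ (\sum_x \sum_y (q x + q y) / 2)).
    apply: ler_sum => x _; apply: ler_sum => y _; rewrite exprD mxE ler_pdivlMr // mulr_suml.
    rewrite -big_split; apply: ler_sum => z _ /=.
    have -> : (M ^+ k) z y = (M ^+ k) y z by rewrite -{1}symi mxE.
    by have := sqr_ge0 ((M ^+ k) x z - (M ^+ k) y z); lra.
  rewrite trE (eq_bigr (fun x => (n%:R * q x + \sum_y q y) / 2)); last first.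
    by move=> x _; rewrite -mulr_suml big_split sumr_const card_ord mulr_natl.
  rewrite -mulr_suml big_split /= -mulr_sumr sumr_const card_ord -[_ *+ n]mulr_natl.
  by set S := \sum_x q x; lra.
rewrite -(ler_pM2l nF); apply: le_trans up; apply: le_trans low.
by rewrite W0 -exprM mulrC.
Qed.

End TraceBounds.

(** A union bound: each pair of times and each labelling accounts for at most a fraction [e] of the
    trace. Counting [(2 k)^2] pairs, the colliding walks carry at most [8 k^2 e <= 1 / 2] of a
    positive total. *)
Theorem noncolliding_closed_walk (F : realFieldType) (n : nat) (K L : finType)
    (phi : 'I_n -> K) (psi : 'I_n -> L) (M : 'M[F]_n) (k : nat) (e : F) :
    M^T = M -> (forall x y, 0 <= M x y) ->
    (forall x y, phi x = phi y -> M x y = 0) -> (forall x y, psi x = psi y -> M x y = 0) ->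
    (2 <= k)%N -> 0 < e -> e * (16 * k ^ 2)%N%:R <= 1 -> 0 < \tr (M ^+ (2 * k)) ->
    \tr (label_square phi M ^+ k) <= e ^+ k * \tr (M ^+ (2 * k)) ->
    \tr (label_square psi M ^+ k) <= e ^+ k * \tr (M ^+ (2 * k)) ->
  exists x : 'I_n, exists t : seq 'I_n, let w := nth x (x :: t) in
    [/\ w (2 * k)%N = x, forall i, (i < 2 * k)%N -> M (w i) (w i.+1) != 0,
        forall i j, (i < j < 2 * k)%N -> phi (w i) <> phi (w j)
      & forall i j, (i < j < 2 * k)%N -> psi (w i) <> psi (w j)].
Proof.
move=> sM M0 phiM psiM k2 e0 e1 tr0 hphi hpsi; set m := (2 * k)%N in tr0 hphi hpsi *.
pose C (J : finType) (f : 'I_n -> J) i j x (t : m.-tuple 'I_n) :=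
  f (nth x (x :: t) i) == f (nth x (x :: t) j).
pose W x (t : m.-tuple 'I_n) := walk_weight (fun=> M) x t.
have W0 x t : 0 <= W x t by apply: walk_weight_ge0.
have [/existsP[x /existsP[t /and4P[lt wt /forallP nphi /forallP npsi]]]|none] := boolP
  [exists x, [exists t : m.-tuple 'I_n, [&& last x t == x, W x t != 0,
     [forall i : 'I_m, [forall j : 'I_m, (i < j)%N ==> ~~ C _ phi i j x t]] &
     [forall i : 'I_m, [forall j : 'I_m, (i < j)%N ==> ~~ C _ psi i j x t]]]]].
  exists x, t; split.
  - by rewrite -[X in nth _ _ X](size_tuple t) nth_last; apply/eqP.
  - by move=> i im; apply: (@walk_weight_neq0 F n (fun=> M)); rewrite ?size_tuple.
  - move=> i j /andP[ij jm] /eqP; apply/negP.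
    by have /forallP/(_ (Ordinal jm)) := nphi (Ordinal (ltn_trans ij jm)); rewrite ij.
  - move=> i j /andP[ij jm] /eqP; apply/negP.
    by have /forallP/(_ (Ordinal jm)) := npsi (Ordinal (ltn_trans ij jm)); rewrite ij.
exfalso.
pose S (J : finType) (f : 'I_n -> J) (i j : 'I_m) := closed_sum (fun=> M) (C J f i j).
have total : \tr (M ^+ m) <= \sum_(i < m) \sum_(j < m | (i < j)%N) (S _ phi i j + S _ psi i j).
  have -> : \tr (M ^+ m) = closed_sum (fun=> M) (fun _ (_ : m.-tuple 'I_n) => true).
    by rewrite closed_sumT prodr_const card_ord.
  pose g i j x t := (if C _ phi i j x t then W x t else 0) + (if C _ psi i j x t then W x t else 0).
  have SE (i j : 'I_m) : S _ phi i j + S _ psi i j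
      = \sum_x \sum_(t : m.-tuple 'I_n | last x t == x) g i j x t.
    rewrite -big_split; apply: eq_bigr => x _ /=.
    by rewrite !big_mkcondr -big_split.
  have -> : \sum_(i < m) \sum_(j < m | (i < j)%N) (S _ phi i j + S _ psi i j)
      = \sum_x \sum_(t : m.-tuple 'I_n | last x t == x) \sum_(i < m) \sum_(j < m | (i < j)%N) g i j x t.
    transitivity (\sum_(i < m) \sum_x \sum_(t : m.-tuple 'I_n | last x t == x)
        \sum_(j < m | (i < j)%N) g i j x t); last first.
      by rewrite exchange_big; apply: eq_bigr => x _; rewrite exchange_big.
    apply: eq_bigr => i _; rewrite (eq_bigr _ (fun j _ => SE i j)) exchange_big.
    by apply: eq_bigr => x _; rewrite exchange_big.
  apply: ler_sum => x _; rewrite [leLHS]big_mkcondr /=.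
  apply: ler_sum => t lt.
  have R0 (i j : 'I_m) : 0 <= (if C _ phi i j x t then W x t else 0) +
      (if C _ psi i j x t then W x t else 0) by rewrite addr_ge0 //; case: ifP.
  have [->|Wn] := eqVneq (walk_weight (fun=> M) x t) 0.
    by apply: sumr_ge0 => i _; apply: sumr_ge0 => j _; exact: R0.
  have : [exists i : 'I_m, [exists j : 'I_m, (i < j)%N && (C _ phi i j x t || C _ psi i j x t)]].
    move: none; rewrite negb_exists => /forallP/(_ x).
    rewrite negb_exists => /forallP/(_ t); rewrite lt Wn /= negb_and.
    by case/orP => /forallPn[i /forallPn[j]]; rewrite negb_imply negbK => /andP[ij cij];
      apply/existsP; exists i; apply/existsP; exists j; rewrite ij cij ?orbT.
  case/existsP => i /existsP[j /andP[ij cij]].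
  rewrite (bigD1 i) //= (bigD1 j) //=.
  apply: (@le_trans _ _ ((if C _ phi i j x t then W x t else 0) +
      (if C _ psi i j x t then W x t else 0))).
    by case/orP: cij => ->; case: ifP => _; rewrite ?lerDl ?lerDr ?addr0 ?add0r // ?W0.
  rewrite -[leLHS]addr0 -addrA lerD2l addr_ge0 // sumr_ge0 // => *; rewrite ?sumr_ge0 // => *; exact: R0.
have bound : \sum_(i < m) \sum_(j < m | (i < j)%N) (S _ phi i j + S _ psi i j)
    <= \sum_(i < m) \sum_(j < m) (2 * e * \tr (M ^+ m)).
  have R0 : 0 <= 2 * e * \tr (M ^+ m) by rewrite !mulr_ge0 // ltW.
  apply: ler_sum => i _; rewrite big_mkcond; apply: ler_sum => j _; case: ifP => // ij.
  have ijm : (i < j < m)%N by rewrite ij ltn_ord.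
  have h1 := closed_sum_collision_le sM phiM k2 ijm erefl e0 tr0 hphi.
  have h2 := closed_sum_collision_le sM psiM k2 ijm erefl e0 tr0 hpsi.
  by rewrite /S /C -mulrA mulr_natl mulr2n lerD.
have := le_trans total bound.
rewrite !sumr_const card_ord -mulrnA -[_ *+ (m * m)]mulr_natl => hh.
have {}e1 : e * (16 * k%:R ^+ 2) <= 1 by move: e1; rewrite natrM natrX.
have hm : (m * m)%N%:R = 4 * k%:R ^+ 2 :> F by rewrite /m !natrM; ring.
rewrite hm in hh; set T := \tr _ in tr0 hh.
have := ler_wpM2r (ltW tr0) e1; lra.
Qed.

Close Scope ring_scope.

(** * Strips and ladders *)

Ltac lia_on_numbers :=
  repeat match goal with
  | H : forall x : _, _ |- _ => clear H
  | H : is_true (?g _ _) |- _ =>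
      lazymatch g with leq => fail | andb => fail | eq_op => fail | _ => clear H end
  end; lia.

(** Only the values of [u] and [v] below [2 * k] matter; sequences on [nat] make shifted indices
    easy to write. *)
Definition has_strip (A B : finType) (G : A -> B -> bool) (k : nat) : Prop :=
  exists u : nat -> A, exists v : nat -> B,
  [/\ forall i j, i < j < 2 * k -> u i <> u j,
      forall i j, i < j < 2 * k -> v i <> v j
    & forall i, i < 2 * k ->
        [&& G (u i) (v i), G (u i) (v (i.+1 %% (2 * k))) & G (u (i.+1 %% (2 * k))) (v i)]].

Lemma pick_avoiding (T : finType) (P : pred T) (f : nat -> T) (m : nat) :
  m < #|[pred x | P x]| -> exists2 x, P x & forall i, i < m -> f i <> x.
Proof.
move=> mP; have [x /andP[Px xf]] : exists x, P x && (x \notin [seq f i | i <- iota 0 m]).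
  apply/existsP; apply/contraT; rewrite negb_exists => /forallP none.
  have : #|[pred x | P x]| <= #|[pred x | x \in [seq f i | i <- iota 0 m]]|.
    apply: subset_leq_card; apply/subsetP => x; rewrite !inE => Px.
    by have := none x; rewrite Px negbK.
  by rewrite leqNgt (leq_ltn_trans (card_size _)) // size_map size_iota.
exists x => // i im e; move: xf; rewrite -e map_f // mem_iota; lia_on_numbers.
Qed.

(** * Greedy construction of a ladder *)

Section Ladder.
Variables (A B : finType) (G : A -> B -> bool) (k : nat) (c z : B).
Variable f : A -> B -> A -> bool.
Hypothesis k_ge2 : 2 <= k.
Hypothesis neq_cz : c <> z.
Hypothesis f_sym : forall x v y, f x v y -> f y v x.
Hypothesis f_adj : forall x v y, f x v y -> [/\ G x v, G x c & G x z].
Hypothesis f_neq : forall x v y, f x v y -> v <> c /\ v <> z.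
Hypothesis f_many_ends : forall x v y, f x v y -> 2 * k < #|[pred w | f x v w]|.
Hypothesis f_many_middles : forall x v y, f x v y -> 2 * k < #|[pred w | f x w y]|.

(** A ladder [u 1, v 2, u 2, ..., v i, u i]. The indices [0] and [1] of [v] are kept for [c] and
    [z]. The last triple satisfies [f], which is what allows another step. *)
Let partial (i : nat) (u : nat -> A) (v : nat -> B) : Prop :=
  [/\ forall a b, 0 < a < b -> b <= i -> u a <> u b,
      forall a b, 1 < a < b -> b <= i -> v a <> v b,
      forall a, 1 < a <= i -> [/\ G (u a) (v a), G (u a.-1) (v a), v a <> c & v a <> z],
      forall a, 1 < a < i -> G (u a.+1) (v a)
    & (forall a, 0 < a <= i -> G (u a) c /\ G (u a) z) /\ f (u i.-1) (v i) (u i)].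

(** Pivoting twice: first a new end [w] for the cherry centred at [v i], then a new centre [y] for
    the pair [u i], [w]. Richness leaves room to avoid all earlier vertices. *)
Lemma partial_extend i u v : 1 < i -> i.+1 < 2 * k -> partial i u v ->
  exists u', exists v', partial i.+1 u' v'.
Proof.
move=> i1 ik [injU injV adj adj' [adjc fi]].
have fi' := f_sym fi.
have [w fw wU] := @pick_avoiding _ (fun w => f (u i) (v i) w) u i.+1
  (ltn_trans ik (f_many_ends fi')).
have [y fy yV] := @pick_avoiding _ (fun y => f (u i) y w) v i.+1
  (ltn_trans ik (f_many_middles fw)).
exists (fun a => if a == i.+1 then w else u a).
exists (fun a => if a == i.+1 then y else v a).
have [Guy _ _] := f_adj fy; have [Gwy Gwc Gwz] := f_adj (f_sym fy).
have [yc yz] := f_neq fy; have [Gwv _ _] := f_adj (f_sym fw).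
split.
- move=> a b /andP[a0 ab] bi; have -> : (a == i.+1) = false by lia_on_numbers.
  by case: eqP => [_|ne]; [apply: wU; lia_on_numbers | apply: injU; lia_on_numbers].
- move=> a b /andP[a0 ab] bi; have -> : (a == i.+1) = false by lia_on_numbers.
  by case: eqP => [_|ne]; [apply: yV; lia_on_numbers | apply: injV; lia_on_numbers].
- move=> a /andP[a1 ai]; have -> : (a.-1 == i.+1) = false by lia_on_numbers.
  by case: eqP => [->|ne] /=; [split | apply: adj; lia_on_numbers].
- move=> a /andP[a1 ai]; have -> : (a == i.+1) = false by lia_on_numbers.
  case: eqP => [e|ne]; last by apply: adj'; lia_on_numbers.
  by have -> : a = i by lia_on_numbers.
split; last by rewrite /= eqxx (_ : (i == i.+1) = false); last lia_on_numbers.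
by move=> a /andP[a0 ai]; case: eqP => [_|ne]; [split | apply: adjc; lia_on_numbers].
Qed.

(* The ladder [u 1, v 2, u 2, ..., v (2 k - 1), u 0] is closed up by [v 0 = c] and [v 1 = z], which
   are adjacent to all its [u]'s. *)
Lemma strip_of_rich_triples x0 v0 y0 : f x0 v0 y0 -> has_strip G k.
Proof.
move=> f0.
have start : exists u v, partial 2 u v.
  (* Nothing prevents [y0] from being [x0], so a second end different from [x0] is picked. *)
  have [w fw wU] := @pick_avoiding _ (fun w => f x0 v0 w) (fun=> x0) 1
    (leq_trans (ltac:(lia_on_numbers) : 1 < (2 * k).+1) (f_many_ends f0)).
  exists (fun a => if a == 1 then x0 else w); exists (fun=> v0).
  have [G1 G2 G3] := f_adj fw; have [G1' G2' G3'] := f_adj (f_sym fw).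
  have [n1 n2] := f_neq fw.
  split.
  - move=> a b ab b2; have -> : (a == 1) = true by lia_on_numbers.
    by have -> : (b == 1) = false by [lia_on_numbers]; apply: (wU 0).
  - by move=> a b; lia_on_numbers.
  - by move=> a a2; have -> : a = 2 by lia_on_numbers.
  - by move=> a; lia_on_numbers.
  - by split=> // a a2; case: eqP.
have reach i : 1 < i -> i < 2 * k -> exists u v, partial i u v.
  elim: i => [//|i IH] i1 ik; have [e|ne] := eqVneq i 1; first by rewrite e.
  have [||u [v p]] := IH; [by lia_on_numbers|by lia_on_numbers|].
  by apply: (partial_extend _ ik p); lia_on_numbers.
have [||u [v [injU injV adj adj' [adjc fi]]]] := reach (2 * k).-1; [by lia_on_numbers|by lia_on_numbers|].
set i := (2 * k).-1 in injU injV adj adj' adjc fi.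
have fi' := f_sym fi.
(* This [w] becomes [u 0]: it is adjacent to [v (2 k - 1)], and to [c] and [z] like every end of a
   triple of [f]. *)
have [w fw wU] := @pick_avoiding _ (fun w => f (u i) (v i) w) u (2 * k) (f_many_ends fi').
have [Guv Guc Guz] := f_adj fw; have [Gwv Gwc Gwz] := f_adj (f_sym fw).
exists (fun a => if a == 0 then w else u a).
exists (fun a => if a == 0 then c else if a == 1 then z else v a).
have vne a : 1 < a <= i -> v a <> c /\ v a <> z by move=> /adj[].
split.
- move=> a b /andP[ab bk]; have -> : (b == 0) = false by lia_on_numbers.
  case: eqP => [_|a0]; last by apply: injU; lia_on_numbers.
  by move=> e; apply: (wU b).
- move=> a b /andP[ab bk]; have -> : (b == 0) = false by lia_on_numbers.
  have [e|a0] := eqVneq a 0.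
    case: eqP => [//|b1]; have [|n1 _] := vne b; first by lia_on_numbers.
    by move=> e'; apply: n1.
  have -> : (b == 1) = false by lia_on_numbers.
  have [e|a1] := eqVneq a 1; last by apply: injV; lia_on_numbers.
  by have [|_ n2] := vne b; [lia_on_numbers|move=> e'; apply: n2].
move=> a ak; have [ai|ai] := eqVneq a.+1 (2 * k).
  have -> : a = i by lia_on_numbers.
  have i0 : (i == 0) = false by lia_on_numbers.
  have i1 : (i == 1) = false by lia_on_numbers.
  rewrite (_ : i.+1 = 2 * k) ?modnn; last by lia_on_numbers.
  by rewrite /= i0 i1 Guv Guc Gwv.
rewrite modn_small; last by lia_on_numbers.
rewrite /=.
have [e|a0] := eqVneq a 0.
  rewrite e /=; have [|g1 _] := adjc 1; first by lia_on_numbers.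
  by rewrite Gwc Gwz g1.
have [e|a1] := eqVneq a 1.
  rewrite e /=; have [|_ g1] := adjc 1; first by lia_on_numbers.
  have [|_ g2] := adjc 2; first by lia_on_numbers.
  have [|_ g3 _ _] := adj 2; first by lia_on_numbers.
  by rewrite g1 g2 g3.
have -> : (a.+1 == 1) = false by lia_on_numbers.
have [|g1 _ _ _] := adj a; first by lia_on_numbers.
have [|_ g2 _ _] := adj a.+1; first by lia_on_numbers.
have g3 := adj' a ltac:(lia_on_numbers).
by rewrite g1 g2 g3.
Qed.

End Ladder.

Open Scope ring_scope.

(** * Peeling *)

Lemma ler_sum_all (F : numDomainType) (I : finType) (P : pred I) (f : I -> F) :
  (forall i, 0 <= f i) -> \sum_(i | P i) f i <= \sum_i f i.
Proof. by move=> f0; rewrite [leRHS](bigID P) /= lerDl sumr_ge0. Qed.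

Section Peeling.
Variables (F : realFieldType) (T K1 K2 K3 : finType).
Variables (k1 : T -> K1) (k2 : T -> K2) (k3 : T -> K3) (wt : T -> F).
Variables (b1 : K1 -> F) (b2 : K2 -> F) (b3 : K3 -> F) (h : nat).
Hypothesis wt1 : forall t, wt t <= b1 (k1 t).
Hypothesis wt2 : forall t, wt t <= b2 (k2 t).
Hypothesis wt3 : forall t, wt t <= b3 (k3 t).
Hypothesis wt_ge0 : forall t, 0 <= wt t.

Definition rich (X : {set T}) : bool :=
  [forall t in X, [&& (h < #|[set s in X | k1 s == k1 t]|)%N,
     (h < #|[set s in X | k2 s == k2 t]|)%N & (h < #|[set s in X | k3 s == k3 t]|)%N]].

Let block_le (K : finType) (key : T -> K) (b : K -> F) (X : {set T}) (c : K) :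
  (forall t, wt t <= b (key t)) -> c \in key @: X ->
  (#|[set s in X | key s == c]| <= h)%N ->
  \sum_(t in X | key t == c) wt t <= h%:R * b c.
Proof.
move=> wb /imsetP[s sX cE] small.
have b0 : 0 <= b c by rewrite cE; apply: le_trans (wb s).
apply: (@le_trans _ _ (\sum_(t in X | key t == c) b c)).
  by apply: ler_sum => t /andP[_ /eqP <-].
rewrite sumr_const -[leLHS]mulr_natl ler_wpM2r // ler_nat; apply: leq_trans small.
by apply: eq_leq; apply: eq_card => t; rewrite inE.
Qed.

Let images_mono (K : finType) (key : T -> K) (b : K -> F) (X Y : {set T}) :
  (forall t, wt t <= b (key t)) -> Y \subset X ->
  \sum_(c in key @: Y) b c <= \sum_(c in key @: X) b c.
Proof.
move=> wb YX; rewrite [leRHS](big_setID (key @: Y)) /=.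
rewrite (setIidPr (imsetS key YX)) lerDl sumr_ge0 // => c /setDP[/imsetP[t _ ->] _].
exact: le_trans (wb t).
Qed.

Let images_remove (K : finType) (key : T -> K) (b : K -> F) (X : {set T}) c :
  (forall t, wt t <= b (key t)) -> c \in key @: X ->
  b c + \sum_(c' in key @: [set t in X | key t != c]) b c' <= \sum_(c' in key @: X) b c'.
Proof.
move=> wb cX; rewrite [leRHS](bigD1 c) //= lerD2l.
rewrite [leRHS](bigID (mem (key @: [set t in X | key t != c]))) /=.
rewrite -[leLHS]addr0 lerD //.
  rewrite le_eqVlt; apply/orP; left; apply/eqP; apply: eq_bigl => c' /=.
  apply/imsetP/idP => [[t]|/andP[_ /imsetP[t tX ->]]]; last by exists t.
  rewrite inE => /andP[tX tc] ->; rewrite tc imset_f //=.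
  by apply/imsetP; exists t => //; rewrite inE tX.
by apply: sumr_ge0 => c' /andP[/andP[/imsetP[t _ ->] _] _]; apply: le_trans (wb t).
Qed.

(** While something is left, it is not rich, so some key class has at most [h] members. Deleting the
    class costs at most [h] times the bound attached to its key, and the key disappears with it, so
    every key is charged at most once. *)
Lemma peeling_bound (X : {set T}) :
  (forall Y : {set T}, Y \subset X -> Y != set0 -> ~~ rich Y) ->
  \sum_(t in X) wt t <= h%:R *
    (\sum_(c in k1 @: X) b1 c + \sum_(c in k2 @: X) b2 c + \sum_(c in k3 @: X) b3 c).
Proof.
have [m] := ubnP #|X|; elim: m X => // m IH X Xm poor.
have [->|X0] := eqVneq X set0.
  by rewrite !imset0 !big_set0 !addr0 mulr0.
have /forall_inPn[t tX] := poor X (subxx _) X0.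
have sub (K : finType) (key : T -> K) : [set s in X | key s != key t] \subset X.
  by apply/subsetP => s; rewrite inE => /andP[].
have {}IH (K : finType) (key : T -> K) := IH [set s in X | key s != key t].
have {}IH (K : finType) (key : T -> K) : \sum_(s in X | key s != key t) wt s <=
    h%:R * (\sum_(c in k1 @: [set s in X | key s != key t]) b1 c
     + \sum_(c in k2 @: [set s in X | key s != key t]) b2 c
     + \sum_(c in k3 @: [set s in X | key s != key t]) b3 c).
  have := IH K key; rewrite (eq_bigl (fun s => (s \in X) && (key s != key t))); last first.
    by move=> s; rewrite inE.
  apply.
    rewrite ltnS in Xm; apply: leq_trans Xm; apply: proper_card.
    rewrite properE sub; apply/subsetPn; exists t => //.
    by rewrite inE eqxx andbF.
  by move=> Y YX; apply: poor; apply: subset_trans YX (sub _ _).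
have h0 : 0 <= h%:R :> F by rewrite ler0n.
rewrite !negb_and -!leqNgt => /or3P[] small.
- rewrite (bigID (fun s => k1 s == k1 t)) /=.
  have e1 := block_le wt1 (imset_f k1 tX) small.
  have e2 := IH _ k1.
  have e3 := ler_wpM2l h0 (images_remove wt1 (imset_f k1 tX)).
  have e4 := ler_wpM2l h0 (images_mono wt2 (sub _ k1)).
  have e5 := ler_wpM2l h0 (images_mono wt3 (sub _ k1)).
  rewrite !mulrDr in e2 e3 *; lra.
- rewrite (bigID (fun s => k2 s == k2 t)) /=.
  have e1 := block_le wt2 (imset_f k2 tX) small.
  have e2 := IH _ k2.
  have e3 := ler_wpM2l h0 (images_remove wt2 (imset_f k2 tX)).
  have e4 := ler_wpM2l h0 (images_mono wt1 (sub _ k2)).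
  have e5 := ler_wpM2l h0 (images_mono wt3 (sub _ k2)).
  rewrite !mulrDr in e2 e3 *; lra.
- rewrite (bigID (fun s => k3 s == k3 t)) /=.
  have e1 := block_le wt3 (imset_f k3 tX) small.
  have e2 := IH _ k3.
  have e3 := ler_wpM2l h0 (images_remove wt3 (imset_f k3 tX)).
  have e4 := ler_wpM2l h0 (images_mono wt1 (sub _ k3)).
  have e5 := ler_wpM2l h0 (images_mono wt2 (sub _ k3)).
  rewrite !mulrDr in e2 e3 *; lra.
Qed.

End Peeling.

(** * Cherries inside common neighbourhoods *)

Section CherryBound.
Variables (F : realFieldType) (A B : finType) (G : A -> B -> bool) (k : nat) (c : B).
Hypothesis k_ge2 : (2 <= k)%N.
Hypothesis no_strip : ~ has_strip G k.
Variables (m : A -> B -> F) (mmax : F).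
Hypothesis m_ge0 : forall x v, 0 <= m x v.
Hypothesis m_le : forall x v, m x v <= mmax.
Hypothesis m_supp : forall x v, m x v != 0 -> [/\ G x v, G x c & v != c].

Let T : finType := ((A * B) * A)%type.
Local Notation mn x y v := (Num.min (m x v) (m y v)).

(* A triple [(x, v, y)] is a cherry with centre [v] inside the common neighbourhood of [c], [z]. *)
Let poor_at (z : B) (Y : {set T}) :
    (forall t, t \in Y -> [&& t.1.1 != t.2, t.1.2 != z, 0 < m t.1.1 t.1.2, 0 < m t.2 t.1.2,
       0 < m t.1.1 z & 0 < m t.2 z]) -> Y != set0 ->
  ~~ rich (fun t => t.1) (fun t => (t.1.2, t.2)) (fun t => (t.1.1, t.2)) (2 * k) Y.
Proof.
move=> Yt /set0Pn[[[x0 v0] y0] t0]; apply/negP => /forall_inP richY.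
(* Symmetrised because the ladder uses its cherries in both directions. *)
pose f x v y := ((x, v, y) \in Y) || ((y, v, x) \in Y).
have f_m x v y : f x v y -> [/\ v != z, 0 < m x v & 0 < m x z].
  by case/orP => /Yt /and5P[? ? ? ? /andP[? ?]].
have f_G x v y : f x v y -> [/\ G x v, G x c & v != c].
  by move=> /f_m[_ m1 _]; apply: m_supp; rewrite gt_eqF.
have f_Gz x v y : f x v y -> [/\ G x z, G x c & z != c].
  by move=> /f_m[_ _ m1]; apply: m_supp; rewrite gt_eqF.
have f0 : f x0 v0 y0 by rewrite /f t0.
have [_ _ /eqP zc] := f_Gz _ _ _ f0.
apply: no_strip; apply: (@strip_of_rich_triples _ _ G k c z f) f0 => //.
- by move=> e; apply: zc.
- by move=> x v y; rewrite /f orbC.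
- by move=> x v y fx; have [? ? _] := f_G _ _ _ fx; have [? _ _] := f_Gz _ _ _ fx.
- move=> x v y fx; have [_ _ /eqP ?] := f_G _ _ _ fx.
  by have [/eqP ? _ _] := f_m _ _ _ fx.
- move=> x v y /orP[] /richY /= /and3P[h1 h2 h3].
    apply: leq_trans h1 _.
    rewrite -(card_in_imset (f := fun t : T => t.2)); last first.
      move=> [[a b] d] [[a' b'] d'] /=; rewrite !inE /= => /andP[_ /eqP e1] /andP[_ /eqP e2] e3.
      by rewrite e1 e2 e3.
    apply: subset_leq_card; apply/subsetP => w /imsetP[[[a b] d]]; rewrite !inE /=.
    by case/andP=> tY /eqP[e1 e2] ->; rewrite /f -e1 -e2 tY.
  apply: leq_trans h2 _.
  rewrite -(card_in_imset (f := fun t : T => t.1.1)); last first.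
    move=> [[a b] d] [[a' b'] d'] /=; rewrite !inE /= => /andP[_ /eqP[e1 e2]] /andP[_ /eqP[e3 e4]] e5.
    by rewrite e1 e2 e3 e4 e5.
  apply: subset_leq_card; apply/subsetP => w /imsetP[[[a b] d]]; rewrite !inE /=.
  by case/andP=> tY /eqP[e1 e2] ->; rewrite /f -e1 -e2 tY orbT.
- move=> x v y /orP[] /richY /= /and3P[h1 h2 h3]; apply: leq_trans h3 _;
    rewrite -(card_in_imset (f := fun t : T => t.1.2));
    try (move=> [[a b] d] [[a' b'] d'] /=; rewrite !inE /= => /andP[_ /eqP[e1 e2]] /andP[_ /eqP[e3 e4]] e5;
      by rewrite e1 e2 e3 e4 e5);
  apply: subset_leq_card; apply/subsetP => w /imsetP[[[a b] d]]; rewrite !inE /=;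
  by case/andP=> tY /eqP[e1 e2] ->; rewrite /f -e1 -e2 tY ?orbT.
Qed.

(** For each [z], the cherries [(x, v, y)] are peeled with the keys [(x, v)], [(v, y)] and [(x, y)],
    which correspond to a free end, the other free end and a free centre. Summed over [z], the first
    two kinds of key give the two square terms and the third the term with [mmax]. *)
Lemma cherry_bound :
  \sum_x \sum_(y | y != x) \sum_z \sum_(v | v != z) mn x y z * mn x y v
   <= (2 * k)%:R * (2 * \sum_x (\sum_z m x z) ^+ 2 + mmax * \sum_x \sum_y \sum_z mn x y z).
Proof.
have mn0 x y v : 0 <= mn x y v by rewrite le_min !m_ge0.
have mnl x y v : mn x y v <= m x v by rewrite ge_min lexx.
have mnr x y v : mn x y v <= m y v by rewrite ge_min lexx orbT.
pose wt z (t : T) := mn t.1.1 t.2 z * mn t.1.1 t.2 t.1.2.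
pose X z := [set t : T | [&& t.1.1 != t.2, t.1.2 != z, 0 < m t.1.1 t.1.2, 0 < m t.2 t.1.2,
       0 < m t.1.1 z & 0 < m t.2 z]].
have peel z : \sum_(t in X z) wt z t <= (2 * k)%:R *
   (\sum_(p : A * B) m p.1 z * m p.1 p.2 + \sum_(p : B * A) m p.2 z * m p.2 p.1
     + \sum_(p : A * A) mn p.1 p.2 z * mmax).
  apply: le_trans (@peeling_bound F T _ _ _ (fun t => t.1) (fun t => (t.1.2, t.2))
    (fun t => (t.1.1, t.2)) (wt z) (fun p => m p.1 z * m p.1 p.2)
    (fun p => m p.2 z * m p.2 p.1) (fun p => mn p.1 p.2 z * mmax) (2 * k) _ _ _ _ (X z) _) _.
  - by move=> t; rewrite /wt ler_pM.
  - by move=> t; rewrite /wt ler_pM.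
  - by move=> t; rewrite /wt ler_wpM2l //; apply: le_trans (mnl _ _ _) (m_le _ _).
  - by move=> t; rewrite /wt mulr_ge0.
  - move=> Y YX; apply: (@poor_at z); move=> t /(subsetP YX).
    by rewrite inE.
  have mmax0 x v : 0 <= mn x x v * mmax by rewrite mulr_ge0 //; apply: le_trans (m_le x v).
  rewrite ler_wpM2l ?ler0n // !lerD //; apply: ler_sum_all => p; rewrite ?mulr_ge0 //.
  by apply: le_trans (m_le p.1 z).
have total z : \sum_x \sum_(y | y != x) \sum_(v | v != z) mn x y z * mn x y v
    = \sum_(t in X z) wt z t.
  transitivity (\sum_(t : T | (t.1.1 != t.2) && (t.1.2 != z)) wt z t); last first.
    rewrite [RHS]big_mkcond [LHS]big_mkcond; apply: eq_bigr => t _; rewrite inE.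
    do 2![case: (_ != _) => //=]; rewrite !lt_def !m_ge0 !andbT /wt.
    have mn_eq0 x y v : m x v = 0 \/ m y v = 0 -> mn x y v = 0.
      move=> e; apply/le_anti; rewrite mn0 andbT.
      by case: e => <-.
    have [e|_] := eqVneq (m t.1.1 t.1.2) 0; first by rewrite (mn_eq0 _ _ t.1.2) ?mulr0 //; left.
    have [e|_] := eqVneq (m t.2 t.1.2) 0; first by rewrite (mn_eq0 _ _ t.1.2) ?mulr0 //; right.
    have [e|_] := eqVneq (m t.1.1 z) 0; first by rewrite mn_eq0 ?mul0r //; left.
    by have [e|_] := eqVneq (m t.2 z) 0; first by rewrite mn_eq0 ?mul0r //; right.
  transitivity (\sum_x \sum_v \sum_y if (x != y) && (v != z) then wt z (x, v, y) else 0).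
    apply: eq_bigr => x _; rewrite big_mkcond [RHS]exchange_big; apply: eq_bigr => y _ /=.
    rewrite eq_sym; case: (x != y) => /=; last by rewrite big1.
    by rewrite big_mkcond.
  rewrite [RHS]big_mkcond pair_big /=.
  rewrite (pair_big xpredT xpredT (fun (p : A * B) y => if (p.1 != y) && (p.2 != z) then wt z (p.1, p.2, y) else 0)) /=.
  by apply: eq_bigr => -[[x v] y] _.
have -> : \sum_x \sum_(y | y != x) \sum_z \sum_(v | v != z) mn x y z * mn x y v
    = \sum_z \sum_(t in X z) wt z t.
  rewrite -(eq_bigr _ (fun z _ => total z)) [RHS]exchange_big; apply: eq_bigr => x _.
  by rewrite [RHS]exchange_big.
apply: le_trans (ler_sum _ (fun z _ => peel z)) _.
rewrite -mulr_sumr ler_wpM2l ?ler0n // !big_split /= le_eqVlt; apply/orP; left; apply/eqP.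
have h1 : \sum_z \sum_(p : A * B) m p.1 z * m p.1 p.2 = \sum_x (\sum_z m x z) ^+ 2.
  rewrite (eq_bigr (fun z => \sum_x \sum_v m x z * m x v)) => [|z _]; last by rewrite pair_big.
  rewrite exchange_big; apply: eq_bigr => x _; rewrite expr2 mulr_suml.
  by apply: eq_bigr => z _; rewrite mulr_sumr.
have h2 : \sum_z \sum_(p : B * A) m p.2 z * m p.2 p.1 = \sum_x (\sum_z m x z) ^+ 2.
  rewrite -h1; apply: eq_bigr => z _.
  rewrite -(pair_big xpredT xpredT (fun v x => m x z * m x v)) exchange_big pair_big.
  by apply: eq_bigr.
have h3 : \sum_z \sum_(p : A * A) mn p.1 p.2 z * mmax = mmax * \sum_x \sum_y \sum_z mn x y z.
  rewrite exchange_big -(pair_big xpredT xpredT (fun x y => \sum_z mn x y z * mmax)) /=.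
  rewrite mulr_sumr; apply: eq_bigr => x _; rewrite mulr_sumr; apply: eq_bigr => y _.
  by rewrite -mulr_suml mulrC.
by rewrite h1 h2 h3; ring.
Qed.

End CherryBound.

(** * Heavy sets *)

Lemma subset_of_card (T : finType) (S : {set T}) (n : nat) :
  (n <= #|S|)%N -> exists2 R : {set T}, R \subset S & #|R| = n.
Proof.
move=> nS; exists [set x in take n (enum S)].
  by apply/subsetP => x; rewrite inE => /mem_take; rewrite mem_enum.
rewrite cardsE (card_uniqP _) ?take_uniq ?enum_uniq //.
by rewrite size_takel // -cardE.
Qed.

Lemma approx_sqrt (d : nat) : (0 < d)%N -> exists s, (d <= s * s <= 4 * d)%N.
Proof.
move=> d0; have exS : exists s, (d <= s * s)%N by exists d; nia.
have [s ds smin] := ex_minnP exS; exists s; rewrite ds /=.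
case: s ds smin => [|[|s]] ds smin; [by []|by lia|].
rewrite leqNgt; apply/negP => bad.
by have := smin s.+1 ltac:(nia); lia.
Qed.

(** * Codegrees and dense sets around a vertex *)

Section Codegrees.
Variables (F : realFieldType) (A B : finType) (G : A -> B -> bool) (k : nat).
Hypothesis k_ge2 : (2 <= k)%N.
Hypothesis no_strip : ~ has_strip G k.
Local Notation h := (2 * k)%N.

(** This is [cherry_bound] for indicator weights: the left side counts ordered pairs of distinct
    elements of [I x :&: I y]. *)
Lemma codegree_bound (c : B) (I : A -> {set B}) :
    (forall x z, z \in I x -> [/\ G x z, G x c & z != c]) ->
  \sum_x \sum_(y | y != x) (#|I x :&: I y|%:R ^+ 2 - #|I x :&: I y|%:R) <=
    h%:R * (2 * \sum_x #|I x|%:R ^+ 2 + \sum_x \sum_y #|I x :&: I y|%:R) :> F.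
Proof.
move=> IG; pose m x z : F := (z \in I x)%:R.
have mnE x y z : Num.min (m x z) (m y z) = (z \in I x :&: I y)%:R.
  rewrite inE /m; do 2![case: (_ \in _)] => //=.
  - by rewrite minxx.
  - by rewrite min_r // ler01.
  - by rewrite min_l // ler01.
  - by rewrite minxx.
have sumE (S : {set B}) : \sum_z (z \in S)%:R = #|S|%:R :> F.
  by rewrite -natr_sum -big_mkcond sum1_card.
have m_supp x v : m x v != 0 -> [/\ G x v, G x c & v != c].
  by move=> mx; apply: IG; move: mx; rewrite /m; case: (_ \in _) => //; rewrite eqxx.
have m0 x v : 0 <= m x v by rewrite ler0n.
have m1 x v : m x v <= 1 by rewrite /m; case: (_ \in _).
have := cherry_bound k_ge2 no_strip m0 m1 m_supp; rewrite mul1r.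
have -> : \sum_x (\sum_z m x z) ^+ 2 = \sum_x #|I x|%:R ^+ 2.
  by apply: eq_bigr => x _; rewrite sumE.
have -> : \sum_x \sum_y \sum_z Num.min (m x z) (m y z) = \sum_x \sum_y #|I x :&: I y|%:R.
  apply: eq_bigr => x _; apply: eq_bigr => y _; rewrite -sumE.
  by apply: eq_bigr => z _; rewrite mnE.
apply: le_trans; rewrite le_eqVlt; apply/orP; left; apply/eqP.
apply: eq_bigr => x _; apply: eq_bigr => y _; set S := I x :&: I y.
transitivity (\sum_z (z \in S)%:R * (#|S|%:R - (z \in S)%:R) : F).
  rewrite -(eq_bigr _ (fun z _ => esym (mulrBr _ _ _))) sumrB -mulr_suml sumE expr2.
  by rewrite -[#|S|%:R in X in _ - X]sumE; congr (_ - _); apply: eq_bigr => z _; case: (_ \in _); rewrite ?mulr1 ?mulr0.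
apply: eq_bigr => z _; rewrite -sumE (bigD1 z) //= addrC addrK mulr_sumr.
by apply: eq_bigr => v _; rewrite !mnE.
Qed.

Variable d : nat.
Hypothesis d_gt0 : (0 < d)%N.
Hypothesis regG : forall y, #|[set x | G x y]| = d.
Local Notation L := (32 * h.+1)%N.
Variable s : nat.
Hypothesis s_lower : (d <= s * s)%N.

Definition degree_in (Z : {set B}) (x : A) : nat := #|[set z in Z | G x z]|.
(** The cap [s] keeps the square sum in [codegree_bound] below [d * s ^ 2]. *)
Definition capped_edges (c : B) (Z : {set B}) : nat :=
  (\sum_(x | G x c) minn (degree_in Z x) s)%N.

(** Let [T] be the sum of the codegrees of the capped neighbourhoods. Density and Cauchy-Schwarz
    over [Z] force [T] to be at least [L * s] times the number of capped edges, hence at least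
    [L * s ^ 2] per saturated vertex. In the other direction [codegree_bound] bounds [T ^+ 2]. *)
Lemma few_saturated c (Z : {set B}) : c \notin Z -> (L * s * #|Z| <= capped_edges c Z)%N ->
  (16 * #|[set x | G x c && (s <= degree_in Z x)%N]| <= d)%N.
Proof.
move=> cZ dense; set S := [set x | _ && _].
(* Each neighbour [x] of [c] keeps as many neighbours in [Z] as the cap allows, which turns the
   capped count into honest sets. *)
have [I IP] : exists I : A -> {set B}, forall x, I x \subset [set z in Z | G x z] /\
    #|I x| = if G x c then minn (degree_in Z x) s else 0%N.
  apply: (fin_all_exists (P := fun x (R : {set B}) => R \subset [set z in Z | G x z] /\
    #|R| = if G x c then minn (degree_in Z x) s else 0%N)) => x.
  have [|R RS Rc] := @subset_of_card _ [set z in Z | G x z]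
    (if G x c then minn (degree_in Z x) s else 0%N); last by exists R.
  by case: (G x c); rewrite // geq_minl.
have I0 x : G x c = false -> I x = set0.
  by move=> nG; apply: cards0_eq; have [_ ->] := IP x; rewrite nG.
have IG x z : z \in I x -> [/\ G x z, G x c & z != c].
  move=> zI; have [/subsetP/(_ z zI)] := IP x; rewrite inE => /andP[zZ ->] _.
  case E : (G x c); last by rewrite (I0 x E) inE in zI.
  by split=> //; apply: contraNneq cZ => <-.
have := codegree_bound IG.
set pi := fun x y : A => #|I x :&: I y|%:R : F.
set Q := \sum_x _ ^+ 2; set T := \sum_x \sum_y _ => bound.
have diag x : pi x x = #|I x|%:R by rewrite /pi setIid.
have sq : \sum_x \sum_y pi x y ^+ 2 <= (2 * h%:R + 1) * Q + (h%:R + 1) * T.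
  have eQ : \sum_x \sum_y pi x y ^+ 2 = Q + \sum_x \sum_(y | y != x) pi x y ^+ 2.
    by rewrite -big_split; apply: eq_bigr => x _; rewrite (bigD1 x) //= diag.
  have eT : \sum_x \sum_(y | y != x) pi x y <= T.
    by apply: ler_sum => x _; apply: ler_sum_all => y; rewrite ler0n.
  have : \sum_x \sum_(y | y != x) (pi x y ^+ 2 - pi x y) =
     \sum_x \sum_(y | y != x) pi x y ^+ 2 - \sum_x \sum_(y | y != x) pi x y.
    by rewrite -sumrB; apply: eq_bigr => x _; rewrite sumrB.
  by rewrite eQ => e; rewrite e in bound; rewrite mulrDr mulrA in bound; lra.
have cardN : #|[pred x | G x c]| = d by rewrite -(regG c); apply: eq_card => x; rewrite !inE.
have Qle : Q <= d%:R * s%:R ^+ 2.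
  rewrite -cardN -sum1_card natr_sum mulr_suml /Q [leLHS](bigID (fun x => G x c)) /=.
  rewrite [X in _ + X]big1 ?addr0 => [|x /negbTE nx]; last by rewrite I0 // cards0 expr0n.
  apply: ler_sum => x Gx; rewrite mul1r lerXn2r ?nnegrE ?ler0n // ler_nat.
  by have [_ ->] := IP x; rewrite Gx geq_minr.
have TQ : T ^+ 2 <= d%:R ^+ 2 * \sum_x \sum_y pi x y ^+ 2.
  pose nz (p : A * A) : F := (G p.1 c && G p.2 c)%:R.
  have := cauchy_schwarz_sum nz (fun p => pi p.1 p.2).
  have -> : \sum_p nz p * pi p.1 p.2 = T.
    rewrite /T pair_big; apply: eq_bigr => -[x y] _ /=; rewrite /nz /=.
    case E : (G x c && G y c); first by rewrite mul1r.
    rewrite mul0r; apply/esym/eqP; rewrite pnatr_eq0 cards_eq0.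
    by move: E; case E1 : (G x c) => /= E2; [rewrite (I0 _ E2) setI0 | rewrite (I0 _ E1) set0I].
  have -> : \sum_p nz p ^+ 2 = d%:R ^+ 2.
    rewrite (eq_bigr (fun p : A * A => (G p.1 c)%:R * (G p.2 c)%:R : F)); last first.
      by move=> [x y] _; rewrite /nz /=; do 2![case: (G _ _)]; rewrite /= ?expr1n ?mulr1 ?mulr0 ?expr0n.
    rewrite -(pair_big xpredT xpredT (fun x y => (G x c)%:R * (G y c)%:R : F)) /=.
    under eq_bigr do rewrite -mulr_sumr.
    by rewrite -mulr_suml -natr_sum -big_mkcond sum1_card cardN expr2.
  by rewrite pair_big.
pose q z : F := \sum_x (z \in I x)%:R.
have eE : (capped_edges c Z)%:R = \sum_(z in Z) q z.
  rewrite /q exchange_big /= /capped_edges natr_sum big_mkcond; apply: eq_bigr => x _.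
  have -> : \sum_(z in Z) (z \in I x)%:R = #|I x|%:R :> F.
    rewrite -sum1_card natr_sum [RHS]big_mkcond [LHS]big_mkcond; apply: eq_bigr => z _.
    case E : (z \in I x); last by case: ifP.
    by have [/subsetP/(_ z E)] := IP x; rewrite inE => /andP[->].
  by have [_ ->] := IP x; case: (G x c).
have TE : T = \sum_z q z ^+ 2.
  rewrite (eq_bigr (fun z => \sum_x \sum_y (z \in I x :&: I y)%:R : F)).
    rewrite exchange_big; apply: eq_bigr => x _; rewrite exchange_big; apply: eq_bigr => y _.
    by rewrite -natr_sum -big_mkcond sum1_card.
  move=> z _; rewrite expr2 mulr_suml; apply: eq_bigr => x _; rewrite mulr_sumr.
  by apply: eq_bigr => y _; rewrite inE; do 2![case: (_ \in _)]; rewrite ?mulr1 ?mulr0.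
have eZ : (capped_edges c Z)%:R ^+ 2 <= #|Z|%:R * T.
  have := cauchy_schwarz_sum (fun z => (z \in Z)%:R : F) q.
  have -> : \sum_z (z \in Z)%:R * q z = (capped_edges c Z)%:R.
    by rewrite eE [RHS]big_mkcond; apply: eq_bigr => z _; case: (_ \in _); rewrite ?mul1r ?mul0r.
  have -> : \sum_z ((z \in Z)%:R : F) ^+ 2 = #|Z|%:R.
    rewrite -sum1_card natr_sum [RHS]big_mkcond; apply: eq_bigr => z _.
    by case: (_ \in _); rewrite ?expr1n ?expr0n.
  by rewrite TE.
set n := #|_|.
have ne : (n * s <= capped_edges c Z)%N.
  rewrite /n -sum1_card big_distrl /= /capped_edges big_mkcond [leqRHS]big_mkcond /=.
  apply: leq_sum => x _; rewrite inE; case: (G x c) => //=.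
  case: ifP => [st|_]; [by rewrite mul1n leq_min st leqnn | exact: leq0n].
move: ne dense eZ; set e := capped_edges c Z => ne dense eZ.
have s0 : (0 < s)%N by case: (s) s_lower => //; lia.
have [e0|e0] := eqVneq e 0%N.
  by have -> : n = 0%N by [nia]; rewrite muln0.
have T0 : 0 <= T by rewrite TE sumr_ge0 // => z _; apply: sqr_ge0.
have eT : (L * s * e)%N%:R <= T.
  have e1 : 0 < e%:R :> F by rewrite ltr0n lt0n.
  rewrite -(ler_pM2l e1); apply: (@le_trans _ _ ((L * s)%N%:R * e%:R ^+ 2)).
    by rewrite natrM; lra.
  apply: (@le_trans _ _ ((L * s)%N%:R * (#|Z|%:R * T))); first by rewrite ler_wpM2l.
  by rewrite mulrA -natrM ler_wpM2r // ler_nat.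
have nT : ((L * s) * (n * s))%N%:R <= T.
  by apply: le_trans eT; rewrite ler_nat leq_mul2l ne orbT.
pose H : F := h.+1%:R; pose D : F := d%:R; pose X : F := n%:R; pose s2 : F := s%:R ^+ 2.
have H1 : 1 <= H by rewrite ler1n.
have D0 : 0 < D by rewrite ltr0n.
have X0 : 0 <= X by rewrite ler0n.
have sD : D <= s2 by rewrite /D /s2 -natrX ler_nat -mulnn.
have hT : 32 * H * X * s2 <= T.
  by apply: le_trans nT; rewrite !natrM -/H -/X /s2; lra.
have sqT : T ^+ 2 <= D ^+ 2 * (2 * H * (D * s2) + H * T).
  apply: le_trans TQ _; rewrite ler_wpM2l ?sqr_ge0 //; apply: le_trans sq _.
  have eH : H = h%:R + 1 by rewrite /H -natr1.
  have h0 : 0 <= h%:R :> F by rewrite ler0n.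
  rewrite -eH lerD2r; apply: (@le_trans _ _ (2 * H * Q)).
    have Q0 : 0 <= Q by rewrite sumr_ge0 // => x _; apply: sqr_ge0.
    by rewrite ler_wpM2r // eH; lra.
  by rewrite ler_wpM2l // mulr_ge0 // eH addr_ge0.
rewrite -(ler_nat F) natrM -/X -/D.
(* If [T] is small, its lower bound is enough. Otherwise the linear term of [sqT] is absorbed into
   half of [T ^+ 2]. *)
have [small|big] := lerP T (2 * H * D ^+ 2).
  have {}hT : 32 * H * X * D <= 2 * H * D ^+ 2.
    apply: le_trans small; apply: le_trans hT; rewrite ler_wpM2l // !mulr_ge0 //; lra.
  have HD : 0 < 2 * H * D by rewrite !mulr_gt0 //; lra.
  by rewrite -(ler_pM2l HD); rewrite expr2 in hT; lra.
have T2 : T ^+ 2 <= 4 * H * D ^+ 3 * s2.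
  have HT : H * D ^+ 2 * T <= T ^+ 2 / 2.
    by have := ler_wpM2r T0 (ltW big); rewrite -[T * T]expr2; lra.
  by rewrite !exprS expr0 in sqT HT *; lra.
have s20 : 0 < s2 by apply: lt_le_trans sD.
have big2 : (32 * H * X * s2) ^+ 2 <= 4 * H * D ^+ 3 * s2.
  apply: le_trans T2; rewrite lerXn2r ?nnegrE //.
  by rewrite !mulr_ge0 // ltW //; lra.
have big3 : (32 * H * X) ^+ 2 * s2 <= 4 * H * D ^+ 3.
  by rewrite -(ler_pM2r s20); apply: le_trans big2; rewrite le_eqVlt; apply/orP; left; apply/eqP; ring.
have big4 : (32 * H * X) ^+ 2 <= 4 * H * D ^+ 2.
  rewrite -(ler_pM2r D0); apply: (@le_trans _ _ ((32 * H * X) ^+ 2 * s2)).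
    by rewrite ler_wpM2l // sqr_ge0.
  by apply: le_trans big3 _; rewrite le_eqVlt; apply/orP; left; apply/eqP; ring.
have big5 : (16 * X) ^+ 2 <= D ^+ 2.
  have H0 : 0 < 4 * H by lra.
  rewrite -(ler_pM2l H0); apply: le_trans big4.
  have := ler_wpM2l (mulr_ge0 (ltW H0) (sqr_ge0 (16 * X))) H1.
  rewrite !exprS expr0; lra.
by rewrite -(@ler_pXn2r _ 2) // nnegrE; [apply: mulr_ge0 | apply: ltW].
Qed.

(* [Z] is maximal among the sets with at least [L s |Z|] capped edges: a vertex outside [Z] with
   many unsaturated neighbours could be added to it. *)
Lemma heavy_set c : exists Z : {set B},
  [/\ c \notin Z,
      (15 * d <= 16 * #|[set x | G x c && (degree_in Z x < s)%N]|)%N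
    & forall z, z != c -> z \notin Z ->
        (#|[set x | [&& G x c, (degree_in Z x < s)%N & G x z]]| < L * s)%N].
Proof.
pose good (Z : {set B}) := (c \notin Z) && (L * s * #|Z| <= capped_edges c Z)%N.
have good0 : good set0 by rewrite /good inE cards0 muln0.
case: (arg_maxnP (fun Z : {set B} => #|Z|) good0) => Z /andP[cZ dense] maxZ.
exists Z; split=> //.
  have few := few_saturated cZ dense.
  have := cardsID [set x | (s <= degree_in Z x)%N] [set x | G x c].
  rewrite regG (_ : _ :&: _ = [set x | G x c && (s <= degree_in Z x)%N]); last first.
    by apply/setP => x; rewrite !inE.
  rewrite (_ : _ :\: _ = [set x | G x c && (degree_in Z x < s)%N]); last first.
    by apply/setP => x; rewrite !inE -ltnNge andbC.
  move: few; lia.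
move=> z zc zZ; rewrite ltnNge; apply/negP => many.
have : (#|z |: Z| <= #|Z|)%N.
  apply: maxZ; rewrite /good !inE negb_or eq_sym zc cZ /=.
  rewrite cardsU1 zZ mulnDr muln1.
  apply: leq_trans (leq_add many dense) _.
  have -> : #|[set x | [&& G x c, (degree_in Z x < s)%N & G x z]]|
      = (\sum_(x | G x c) (degree_in Z x < s)%N && G x z)%N.
    rewrite -sum1_card big_mkcond [RHS]big_mkcond; apply: eq_bigr => x _.
    by rewrite inE; case: (G x c) => //=; case: (_ && _).
  rewrite /capped_edges -big_split; apply: leq_sum => x Gxc /=.
  have -> : degree_in (z |: Z) x = (G x z + degree_in Z x)%N.
    rewrite /degree_in; case E : (G x z).
      rewrite (_ : [set w in z |: Z | G x w] = z |: [set w in Z | G x w]).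
        by rewrite cardsU1 inE (negbTE zZ).
      by apply/setP => w; rewrite !inE; case: eqP => // ->; rewrite E.
    rewrite add0n; apply: eq_card => w; rewrite !inE.
    by case: eqP => // ->; rewrite E andbF andbF.
  case: (G x z); rewrite ?andbF //= andbT.
  by case: ltnP; lia.
by rewrite cardsU1 zZ; lia.
Qed.

End Codegrees.

(** * Weighted 4-cycles *)

Section Weights.
Variables (F : realFieldType) (A B : finType) (G : A -> B -> bool) (k d s : nat).
Hypothesis k_ge2 : (2 <= k)%N.
Hypothesis no_strip : ~ has_strip G k.
Hypothesis d_ge16 : (16 <= d)%N.
Hypothesis regG : forall y, #|[set x | G x y]| = d.
Hypothesis s_upper : (s * s <= 4 * d)%N.
Local Notation h := (2 * k)%N.
Local Notation L := (32 * h.+1)%N.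
Local Notation p0 := (8 * (2 * L).+1)%N.

Variable Z : B -> {set B}.
(** Dropping the saturated neighbours bounds the degrees into [Z c] by [s] and loses at most a
    sixteenth of the neighbourhood. *)
Definition core (c : B) : {set A} := [set x | G x c && (degree_in G (Z c) x < s)%N].
Hypothesis Z_self : forall c, c \notin Z c.
Hypothesis core_large : forall c, (15 * d <= 16 * #|core c|)%N.
Hypothesis core_light : forall c z, z != c -> z \notin Z c ->
  (#|[set x | [&& G x c, (degree_in G (Z c) x < s)%N & G x z]]| < L * s)%N.

Definition common (x w : A) : {set B} := [set c | (x \in core c) && (w \in core c)].

(* [(x, c)] and [(w, z)] are edges of opposite sides of the 4-cycle [x c w z]. *)
Definition admissible (x : A) (c : B) (w : A) (z : B) : bool :=
  [&& x != w, c != z, (z \notin Z c) && (c \notin Z z), (c \in common x w) && (z \in common x w)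
    & (p0 <= #|common x w|)%N].

Definition weight x c w z : F := if admissible x c w z then #|common x w|%:R^-1 else 0.

Lemma in_common c x w : (c \in common x w) = (x \in core c) && (w \in core c).
Proof. by rewrite in_set. Qed.

Lemma commonC x w : common x w = common w x.
Proof. by apply/setP => c; rewrite !inE andbC. Qed.

Lemma weight_sym x c w z : weight x c w z = weight w z x c.
Proof.
rewrite /weight /admissible commonC [w == x]eq_sym [z == c]eq_sym.
by rewrite [(c \notin Z z) && _]andbC [(z \in _) && _]andbC.
Qed.

Lemma weight_ge0 x c w z : 0 <= weight x c w z.
Proof. by rewrite /weight; case: ifP => // _; rewrite invr_ge0. Qed.

Lemma weight_le1 x c w z : weight x c w z <= 1.
Proof.
rewrite /weight; case: ifP => // /and5P[_ _ _ _ p].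
rewrite invf_le1 ?ler1n ?ltr0n; by apply: leq_trans p.
Qed.

Lemma weight_neq0 x c w z : weight x c w z != 0 ->
  [/\ x != w, c != z, z \notin Z c, x \in core c & w \in core c] /\
  [/\ x \in core z & w \in core z].
Proof.
rewrite /weight; case: ifP => [|_]; last by rewrite eqxx.
by case/and5P => -> -> /andP[-> _] /andP[]; rewrite !inE => /andP[-> ->] /andP[-> ->].
Qed.

Lemma core_adj x c : x \in core c -> G x c.
Proof. by rewrite inE => /andP[]. Qed.

Lemma card_core_le c : (#|core c| <= d)%N.
Proof.
rewrite -(regG c); apply: subset_leq_card; apply/subsetP => x; rewrite !inE.
by case/andP.
Qed.

Lemma sum_mem (T : finType) (S : {set T}) : \sum_x (x \in S)%:R = #|S|%:R :> F.
Proof. by rewrite -natr_sum -big_mkcond sum1_card. Qed.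

Lemma sum_weight_z x c w : \sum_z weight x c w z <= (x \in core c)%:R * (w \in core c)%:R.
Proof.
have [inC|notC] := boolP ((x \in core c) && (w \in core c)); last first.
  rewrite big1 ?mulr_ge0 // => z _; apply/eqP; apply: contraNT notC => /weight_neq0.
  by case=> -[_ _ _ -> ->].
have [-> ->] := andP inC; rewrite mulr1.
apply: (@le_trans _ _ (\sum_(z in common x w) #|common x w|%:R^-1)).
  rewrite [leRHS]big_mkcond; apply: ler_sum => z _; rewrite /weight.
  case: ifP => [/and5P[_ _ _ /andP[_ ->]] //|_]; by case: ifP => // _; rewrite invr_ge0.
rewrite sumr_const -[leLHS]mulr_natl mulfV // pnatr_eq0 -lt0n.
by apply/card_gt0P; exists c; rewrite inE.
Qed.

(** The weight of the steps from the state [(x, c)] to states with second label [z], that is, of the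
    4-cycles containing the path [c x z]. *)
Definition mass c x z : F := \sum_w weight x c w z.

Lemma mass_ge0 c x z : 0 <= mass c x z.
Proof. by apply: sumr_ge0 => w _; apply: weight_ge0. Qed.

Lemma sum_mass_z c x : \sum_z mass c x z <= d%:R * (x \in core c)%:R.
Proof.
rewrite exchange_big /=; apply: (le_trans (ler_sum _ (fun w _ => sum_weight_z x c w))).
rewrite -mulr_sumr sum_mem mulrC ler_wpM2r // ler_nat; exact: card_core_le.
Qed.

Lemma sum_mass c : \sum_x \sum_z mass c x z <= d%:R * d%:R.
Proof.
apply: (le_trans (ler_sum _ (fun x _ => sum_mass_z c x))).
by rewrite -mulr_sumr sum_mem ler_wpM2l // ler_nat card_core_le.
Qed.

Lemma card_light c z : z != c -> z \notin Z c -> \sum_x ((x \in core c) && G x z)%:R <= (L * s)%:R :> F.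
Proof.
move=> zc zZ; rewrite -natr_sum ler_nat; apply: ltnW; apply: leq_ltn_trans (core_light zc zZ).
rewrite -sum1_card [leqRHS]big_mkcond; apply: leq_sum => x _.
by rewrite !inE -andbA; case: [&& _, _ & _].
Qed.

Lemma mass_neq0 c x z : mass c x z != 0 -> [/\ G x z, G x c, z != c & z \notin Z c] /\ x \in core c.
Proof.
have [/existsP[w wn] _|none] := boolP [exists w, weight x c w z != 0].
  have [[_ cz zZ xc _] [xz _]] := weight_neq0 wn.
  by rewrite eq_sym !core_adj.
rewrite /mass big1 ?eqxx // => w _; apply/eqP; apply: contraNT none => wn.
by apply/existsP; exists w.
Qed.

(** The gain from the heavy sets: a contributing [w] lies in [core c] and is adjacent to some [z]
    outside [Z c], which leaves at most [L * s] choices, each of weight at most one. *)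
Lemma mass_le c x z : mass c x z <= (L * s)%:R.
Proof.
have [->|mn] := eqVneq (mass c x z) 0; first by rewrite ler0n.
have [[_ _ zc zZ] _] := mass_neq0 mn.
apply: le_trans (card_light zc zZ); apply: ler_sum => w _.
have [->|wn] := eqVneq (weight x c w z) 0; first by rewrite ler0n.
have [[_ _ _ _ wc] [_ wz]] := weight_neq0 wn.
by rewrite wc (core_adj wz) weight_le1.
Qed.

(** Dominates the two-step weight between the states [(x, c)] and [(y, c)]. *)
Definition overlap c x y : F := \sum_z Num.min (mass c x z) (mass c y z).

(** The square splits into the diagonal [x = y], the squares of single minima, and cherries. With
    [mmax = L * s] and [s ^ 2 <= 4 d] each part is at most a constant times [d ^ 3], the cherries by
    [cherry_bound]. *)
Lemma overlap_sq c : \sum_x \sum_y overlap c x y ^+ 2 <=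
  ((2 * h + 1) + 4 * h.+1 * (L * L))%N%:R * d%:R ^+ 3.
Proof.
set mn := fun x y z => Num.min (mass c x z) (mass c y z).
have mn0 x y v : 0 <= mn x y v by rewrite le_min !mass_ge0.
have mnl x y v : mn x y v <= mass c x v by rewrite ge_min lexx.
have mnr x y v : mn x y v <= mass c y v by rewrite ge_min lexx orbT.
pose S := \sum_x (\sum_z mass c x z) ^+ 2.
pose U := \sum_x \sum_y \sum_z mn x y z.
have d0 : 0 <= d%:R :> F by rewrite ler0n.
have S_le : S <= d%:R ^+ 3.
  apply: (@le_trans _ _ (\sum_x d%:R * \sum_z mass c x z)).
    apply: ler_sum => x _; rewrite expr2 ler_wpM2r ?sumr_ge0 // => [z _|]; first exact: mass_ge0.
    apply: le_trans (sum_mass_z c x) _; case: (_ \in _); rewrite ?mulr1 ?mulr0 //.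
  rewrite -mulr_sumr exprS ler_wpM2l //; exact: sum_mass.
have U_le : U <= (L * s)%:R * d%:R ^+ 2.
  apply: (@le_trans _ _ (\sum_x \sum_z mass c x z * (L * s)%:R)).
    apply: ler_sum => x _; rewrite exchange_big; apply: ler_sum => z _ /=.
    have [e|mx] := eqVneq (mass c x z) 0.
      by rewrite e mul0r big1 // => y _; apply/le_anti; rewrite mn0 andbT -[X in _ <= X]e mnl.
    have [[_ _ zc zZ] _] := mass_neq0 mx.
    apply: le_trans (ler_wpM2l (mass_ge0 c x z) (card_light zc zZ)).
    rewrite mulr_sumr; apply: ler_sum => y _.
    have [e|my] := eqVneq (mass c y z) 0.
      by apply: (le_trans (mnr _ _ _)); rewrite e mulr_ge0 ?mass_ge0.
    by have [[Gyz _ _ _] yc] := mass_neq0 my; rewrite yc Gyz mulr1.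
  under eq_bigr do rewrite -mulr_suml.
  by rewrite -mulr_suml mulrC ler_wpM2l // expr2 sum_mass.
have m_supp x v : mass c x v != 0 -> [/\ G x v, G x c & v != c].
  by case/mass_neq0 => -[].
have := cherry_bound k_ge2 no_strip (mass_ge0 c) (mass_le c) m_supp.
rewrite -/S -/U => cb.
set V := \sum_x \sum_(y | _) _ in cb.
have split : \sum_x \sum_y overlap c x y ^+ 2 <= S + ((L * s)%:R * U + V).
  have eV : V = \sum_x \sum_(y | y != x) \sum_z mn x y z * (overlap c x y - mn x y z).
    apply: eq_bigr => x _; apply: eq_bigr => y _; apply: eq_bigr => z _.
    by rewrite /overlap [X in _ * (X - _)](bigD1 z) //= addrC addrK mulr_sumr.
  have eU : \sum_x \sum_(y | y != x) \sum_z mn x y z ^+ 2 <= (L * s)%:R * U.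
    rewrite mulr_sumr; apply: ler_sum => x _; rewrite mulr_sumr.
    apply: (le_trans (ler_sum_all _ _)) => [y|]; first by apply: sumr_ge0 => z _; apply: sqr_ge0.
    apply: ler_sum => y _; rewrite mulr_sumr; apply: ler_sum => z _.
    by rewrite expr2 ler_wpM2r //; apply: le_trans (mnl _ _ _) (mass_le _ _ _).
  apply: (@le_trans _ _ (S + (\sum_x \sum_(y | y != x) \sum_z mn x y z ^+ 2 + V))); last first.
    by rewrite lerD2l lerD2r.
  rewrite eV -big_split -big_split; apply: ler_sum => x _ /=.
  rewrite (bigD1 x) //= lerD //.
    have -> // : overlap c x x = \sum_z mass c x z.
    by apply: eq_bigr => z _; rewrite minxx.
  rewrite -big_split; apply: ler_sum => y _; rewrite -big_split /=.
  rewrite expr2 [X in X * _]/overlap mulr_suml; apply: ler_sum => z _.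
  by rewrite mulrBr expr2 addrC subrK.
apply: (le_trans split).
have LU := ler_wpM2l (ler0n F (L * s)) U_le.
have Ls : (L * s)%:R * (L * s)%:R <= (4 * (L * L))%N%:R * d%:R :> F.
  by rewrite -!natrM ler_nat; move: s_upper; clear; nia.
have Lsd := ler_wpM2r (exprn_ge0 2 d0) Ls.
have h0 : 0 <= h%:R :> F by rewrite ler0n.
have b1 : (L * s)%:R * U <= (4 * (L * L))%N%:R * d%:R ^+ 3.
  by apply: (le_trans LU); rewrite [d%:R ^+ 3]exprS !mulrA in Lsd *.
have b2 : V <= h%:R * (2 * d%:R ^+ 3 + (4 * (L * L))%N%:R * d%:R ^+ 3).
  apply: (le_trans cb); rewrite ler_wpM2l // lerD // ler_wpM2l //.
have -> : (2 * h + 1 + 4 * h.+1 * (L * L))%N = (2 * h + 1 + h.+1 * (4 * (L * L)))%N.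
  by rewrite [(4 * h.+1)%N]mulnC -mulnA.
rewrite natrD natrM natrD [(h.+1 * _)%:R]natrM -natr1.
set K := (4 * (L * L))%N%:R in b1 b2 *; set D3 := d%:R ^+ 3 in S_le b1 b2 *.
by lra.
Qed.

(** A second moment argument: vertices of the core have fewer than [s] neighbours in [Z c], so
    [codegree_bound] bounds the sum of squared codegrees by order [d ^ 2], while each pair counted
    here has codegree at least [L]. *)
Lemma few_heavy_pairs c :
  (64 * #|[set q : A * A | [&& q.1 != q.2, q.1 \in core c, q.2 \in core c
     & (L <= #|Z c :&: common q.1 q.2|)%N]]| <= d * d)%N.
Proof.
pose I x : {set B} := if x \in core c then [set z in Z c | G x z] else set0.
have IG x z : z \in I x -> [/\ G x z, G x c & z != c].
  rewrite /I; case: ifP => [xc|_]; last by rewrite inE.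
  rewrite inE => /andP[zZ ->]; rewrite (core_adj xc); split=> //.
  by apply: contraTneq zZ => ->.
have := codegree_bound F k_ge2 no_strip IG.
set Q := \sum_x _ ^+ 2; set pi := fun x y => #|I x :&: I y|%:R : F.
pose T := \sum_x \sum_(y | y != x) pi x y.
have pi0 x y : 0 <= pi x y by rewrite ler0n.
have Ix x : #|I x|%:R ^+ 2 <= s%:R ^+ 2 * (x \in core c)%:R :> F.
  rewrite /I; case xc : (x \in core c); last by rewrite cards0 mulr0 expr0n.
  rewrite mulr1 lerXn2r ?nnegrE // ler_nat ltnW //.
  by move: xc; rewrite inE => /andP[].
have Qd : Q <= s%:R ^+ 2 * d%:R.
  apply: (le_trans (ler_sum _ (fun x _ => Ix x))).
  by rewrite -mulr_sumr sum_mem ler_wpM2l ?sqr_ge0 // ler_nat card_core_le.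
have TE : \sum_x \sum_y pi x y <= Q + T.
  rewrite -big_split; apply: ler_sum => x _ /=; rewrite (bigD1 x) //= lerD2r.
  rewrite /pi setIid; case: (#|I x|) => [|i]; first by rewrite expr0n.
  by rewrite expr2 ler_peMr // ler1n.
pose V := \sum_x \sum_(y | y != x) (pi x y ^+ 2 - pi x y); rewrite -/V => cb.
pose H : F := h.+1%:R.
have eH : H = h%:R + 1 by rewrite /H -natr1.
have h0 : 0 <= h%:R :> F by rewrite ler0n.
(* Subtracting [H * pi] with [H = h + 1] absorbs the off-diagonal linear term of
   [codegree_bound]. *)
pose W := \sum_x \sum_(y | y != x) (pi x y ^+ 2 - H * pi x y).
have WV : W = V - h%:R * T.
  rewrite /W /V /T mulr_sumr -sumrB; apply: eq_bigr => x _ /=; rewrite mulr_sumr -sumrB.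
  by apply: eq_bigr => y _; rewrite eH /pi; ring.
have Wle : W <= 3 * h%:R * (s%:R ^+ 2 * d%:R).
  have c1 := ler_wpM2l h0 TE; have c2 := ler_wpM2l h0 Qd.
  rewrite WV; apply: (@le_trans _ _ (3 * (h%:R * Q))); last by lra.
  move: cb; rewrite -/pi mulrDr; lra.
set N := #|_|.
pose good (x y : A) := [&& x != y, x \in core c, y \in core c & (L <= #|Z c :&: common x y|)%N].
have H1 : 1 <= H by rewrite ler1n.
(* The constant is [32 * 31], from [pi >= 32 H]; for other pairs the square is completed at
   [H / 2]. *)
have term x y : 992 * H ^+ 2 * (good x y)%:R - H ^+ 2 * ((x \in core c)%:R * (y \in core c)%:R)
    <= pi x y ^+ 2 - H * pi x y.
  have [inC|notC] := boolP ((x \in core c) && (y \in core c)); last first.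
    have -> : pi x y = 0.
      apply/eqP; rewrite pnatr_eq0 cards_eq0 /I; move: notC.
      by do 2![case: (_ \in core c)]; rewrite ?setI0 ?set0I.
    have -> : good x y = false by move: notC; rewrite /good; do 2![case: (_ \in core c)]; rewrite ?andbF.
    by move: notC; do 2![case: (_ \in core c)]; rewrite //= ?mulr0 ?mul0r ?expr0n ?mulr0 subrr.
  have [xc yc] := andP inC; rewrite xc yc !mulr1.
  have [g|_] := boolP (good x y); last first.
    by rewrite mulr0 add0r; have := sqr_ge0 (pi x y - H / 2); have := sqr_ge0 H; lra.
  rewrite mulr1; have big : 32 * H <= pi x y.
    rewrite /H -natrM ler_nat; have /and4P[_ _ _ g'] := g; apply: leq_trans g' _.
    apply: subset_leq_card; apply/subsetP => z; rewrite /I xc yc !inE.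
    by case/andP => -> /andP[/andP[-> _] /andP[-> _]].
  have : 0 <= (pi x y - 32 * H) * (pi x y + 31 * H) by rewrite mulr_ge0 //; lra.
  by have := sqr_ge0 H; lra.
have Nlow : 992 * H ^+ 2 * N%:R - H ^+ 2 * (d%:R * d%:R) <= W.
  have -> : N%:R = \sum_x \sum_(y | y != x) (good x y)%:R :> F.
    rewrite /N -sum1_card natr_sum big_mkcond.
    rewrite (eq_bigr (fun q : A * A => (good q.1 q.2)%:R : F)); last first.
      by move=> q _; rewrite inE /good; case: [&& _, _, _ & _].
    rewrite -(pair_big xpredT xpredT (fun x y => (good x y)%:R : F)) /=.
    apply: eq_bigr => x _; rewrite [LHS](bigD1 x) //= /good eqxx add0r.
    by [].
  have cc : \sum_x \sum_(y | y != x) ((x \in core c)%:R * (y \in core c)%:R) <= d%:R * d%:R :> F.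
    apply: (@le_trans _ _ (\sum_x \sum_y ((x \in core c)%:R * (y \in core c)%:R))).
      by apply: ler_sum => x _; apply: ler_sum_all => y; rewrite mulr_ge0.
    under eq_bigr do rewrite -mulr_sumr.
    by rewrite -mulr_suml !sum_mem ler_pM // ler_nat card_core_le.
  apply: (@le_trans _ _ (992 * H ^+ 2 * \sum_x \sum_(y | y != x) (good x y)%:R
     - H ^+ 2 * \sum_x \sum_(y | y != x) ((x \in core c)%:R * (y \in core c)%:R))).
    by rewrite lerD2l lerN2 ler_wpM2l // sqr_ge0.
  rewrite !mulr_sumr -sumrB; apply: ler_sum => x _; rewrite !mulr_sumr -sumrB.
  by apply: ler_sum => y _; apply: term.
rewrite -(ler_nat F) !natrM -/N; set D := d%:R : F.
have s4 : s%:R ^+ 2 <= 4 * D by rewrite -natrX -natrM ler_nat -mulnn.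
have D0 : 0 <= D by rewrite ler0n.
have e1 := ler_wpM2l (mulr_ge0 h0 D0) s4.
have H2 : 0 < H ^+ 2 by rewrite exprn_gt0 //; lra.
have hH : h%:R <= H ^+ 2 by rewrite expr2 eH; have := mulr_ge0 h0 h0; lra.
have e2 := ler_wpM2r (mulr_ge0 D0 D0) hH.
have e3 : H ^+ 2 * (992 * N%:R) <= H ^+ 2 * (13 * (D * D)).
  by move: (le_trans Nlow Wle); rewrite -/D; lra.
by rewrite ler_pM2l // in e3; have := ler0n F N; lra.
Qed.

(** Among the ordered pairs [(c, z)] in a common neighbourhood, admissibility excludes the diagonal
    and those in which one vertex lies in the heavy set of the other. If the heavy sets meet it in
    fewer than [L] vertices, each [c] loses at most [2 L + 1] partners, an eighth of [p0]. *)
Lemma pair_weight x w : x != w ->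
  \sum_(c in common x w) ((7 / 8) * (p0 <= #|common x w|)%N%:R
     - 2 * (L <= #|Z c :&: common x w|)%N%:R) <= \sum_c \sum_z weight x c w z.
Proof.
move=> xw; set C := common x w; set p := #|C|.
have [pp|_] := leqP p0 p; last first.
  apply: (@le_trans _ _ 0).
    by apply: sumr_le0 => c _; rewrite mulr0 sub0r oppr_le0 mulr_ge0.
  by apply: sumr_ge0 => c _; apply: sumr_ge0 => z _; apply: weight_ge0.
rewrite mulr1; have p1 : 0 < p%:R :> F by rewrite ltr0n; apply: leq_trans pp.
pose Pr : F := L%:R.
have ppF : 8 * (2 * Pr + 1) <= p%:R by rewrite /Pr -natrM natr1 -natrM ler_nat.
rewrite -(ler_pM2l p1).
apply: (@le_trans _ _ (\sum_(c in C) \sum_(z in C)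
    (1 - (c == z)%:R - (z \in Z c)%:R - (c \in Z z)%:R))); last first.
  rewrite mulr_sumr big_mkcond; apply: ler_sum => c _.
  case cC : (c \in C); last first.
    by rewrite mulr_ge0 ?(ltW p1) // sumr_ge0 // => z _; apply: weight_ge0.
  rewrite mulr_sumr big_mkcond; apply: ler_sum => z _.
  case zC : (z \in C); last by rewrite mulr_ge0 ?(ltW p1) // weight_ge0.
  rewrite /weight /admissible xw -/C cC zC -/p pp /= andbT.
  have pV : p%:R * p%:R^-1 = 1 :> F by rewrite mulfV // gt_eqF.
  case: (c =P z) => _; case: (z \in Z c); case: (c \in Z z); rewrite /= ?pV ?mulr0; lra.
have mem_sum (S : {set B}) : \sum_(z in C) (z \in S)%:R = #|S :&: C|%:R :> F.
  rewrite -sum1_card natr_sum [RHS]big_mkcond [LHS]big_mkcond; apply: eq_bigr => z _.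
  by rewrite in_setI; do 2![case: (_ \in _)].
have sym : \sum_(c in C) \sum_(z in C) (c \in Z z)%:R = \sum_(c in C) #|Z c :&: C|%:R :> F.
  by rewrite exchange_big; apply: eq_bigr => c _; rewrite mem_sum.
have eqs : \sum_(c in C) \sum_(z in C) (c == z)%:R = p%:R :> F.
  rewrite /p -sum1_card natr_sum; apply: eq_bigr => c cC.
  rewrite (bigD1 c) //= eqxx big1 ?addr0 // => z /andP[_ /negbTE zc].
  by rewrite eq_sym zc.
have -> : \sum_(c in C) \sum_(z in C) (1 - (c == z)%:R - (z \in Z c)%:R - (c \in Z z)%:R)
   = \sum_(c in C) (p%:R - 1 - 2 * #|Z c :&: C|%:R) :> F.
  transitivity (\sum_(c in C) \sum_(z in C) 1 - \sum_(c in C) \sum_(z in C) (c == z)%:R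
     - \sum_(c in C) \sum_(z in C) (z \in Z c)%:R - \sum_(c in C) \sum_(z in C) (c \in Z z)%:R : F).
    by rewrite -!sumrB; apply: eq_bigr => c _; rewrite -!sumrB.
  rewrite sym eqs (eq_bigr _ (fun c _ => mem_sum (Z c))).
  rewrite !sumrB -mulr_sumr.
  rewrite !sumr_const -/p; ring.
rewrite mulr_sumr; apply: ler_sum => c _.
have pi_le : #|Z c :&: C|%:R <= Pr + p%:R * (L <= #|Z c :&: C|)%N%:R.
  have [_|small] := leqP L #|Z c :&: C|; last by rewrite mulr0 addr0 ler_nat ltnW.
  rewrite mulr1 -[leLHS]add0r lerD ?ler0n // ler_nat; apply: subset_leq_card.
  exact: subsetIr.
by lra.
Qed.

(** Counts triples [(x, w, c)] through the cores. The diagonal and the pairs of codegree below [p0]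
    each cost at most a sixteenth of [#|B| d ^ 2]; the heavy triples number at most a sixty-fourth
    of it. *)
Lemma total_weight : (16 * p0 * (#|A| * #|A|) <= #|B| * (d * d))%N ->
  #|B|%:R * d%:R ^+ 2 / 4 <= \sum_x \sum_c \sum_w \sum_z weight x c w z.
Proof.
move=> manyA.
pose heavy c x w := (L <= #|Z c :&: common x w|)%N.
have step1 : \sum_x \sum_(w | w != x) \sum_(c in common x w)
    ((7 / 8) * (p0 <= #|common x w|)%N%:R - 2 * (heavy c x w)%:R)
      <= \sum_x \sum_c \sum_w \sum_z weight x c w z.
  apply: ler_sum => x _; rewrite exchange_big /=.
  apply: (@le_trans _ _ (\sum_(w | w != x) \sum_c \sum_z weight x c w z)).
    by apply: ler_sum => w wx; apply: pair_weight; rewrite eq_sym.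
  apply: ler_sum_all => w; apply: sumr_ge0 => c _; apply: sumr_ge0 => z _.
  exact: weight_ge0.
apply: le_trans step1.
have heavy_few : \sum_x \sum_(w | w != x) \sum_(c in common x w) (heavy c x w)%:R
    <= #|B|%:R * (d%:R * d%:R / 64) :> F.
  pose N c := #|[set q : A * A | [&& q.1 != q.2, q.1 \in core c, q.2 \in core c
     & (L <= #|Z c :&: common q.1 q.2|)%N]]|.
  have -> : \sum_x \sum_(w | w != x) \sum_(c in common x w) (heavy c x w)%:R = \sum_c (N c)%:R :> F.
    under eq_bigr do under eq_bigr do rewrite big_mkcond.
    under eq_bigr do rewrite big_mkcond /=.
    rewrite pair_big /=.
    rewrite (eq_bigr (fun q : A * A => \sum_c if (q.2 != q.1) && (c \in common q.1 q.2)
       then (heavy c q.1 q.2)%:R else 0 : F)); last first.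
      by move=> q _; case: (_ != _) => //=; rewrite big1.
    rewrite exchange_big; apply: eq_bigr => c _.
    rewrite /N -sum1_card natr_sum [RHS]big_mkcond; apply: eq_bigr => q _.
    rewrite in_set in_common /= [q.1 == q.2]eq_sym /heavy.
    by case: (q.2 != q.1); case: (q.1 \in core c); case: (q.2 \in core c); case: (L <= _)%N.
  rewrite -[#|B|]sum1_card natr_sum mulr_suml; apply: ler_sum => c _.
  have := few_heavy_pairs c; rewrite -/(N c) -(ler_nat F) !natrM; lra.
pose X c : F := #|core c|%:R.
have thick : \sum_c X c ^+ 2 - \sum_c X c - p0%:R * (#|A|%:R * #|A|%:R)
   <= \sum_x \sum_(w | w != x) \sum_(c in common x w) (p0 <= #|common x w|)%N%:R.
  have -> : \sum_c X c ^+ 2 = \sum_x \sum_w #|common x w|%:R.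
    rewrite (eq_bigr (fun c => \sum_x \sum_w (x \in core c)%:R * (w \in core c)%:R : F)).
      rewrite exchange_big; apply: eq_bigr => x _; rewrite exchange_big; apply: eq_bigr => w _.
      rewrite -sum_mem; apply: eq_bigr => c _; rewrite in_common.
      by do 2![case: (_ \in _)]; rewrite ?mulr1 ?mulr0.
    move=> c _; under eq_bigr do rewrite -mulr_sumr.
    by rewrite -mulr_suml sum_mem expr2.
  have -> : \sum_c X c = \sum_x #|common x x|%:R.
    rewrite (eq_bigr (fun c => \sum_x (x \in core c)%:R : F)) => [|c _]; last by rewrite sum_mem.
    rewrite exchange_big; apply: eq_bigr => x _.
    by rewrite -sum_mem; apply: eq_bigr => c _; rewrite in_common andbb.
  have -> (q : F) : q * (#|A|%:R * #|A|%:R) = \sum_(x : A) \sum_(w : A) q.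
    by rewrite !sumr_const -mulrnA -[RHS]mulr_natl natrM mulrC.
  rewrite -!sumrB; apply: ler_sum => x _.
  rewrite (bigD1 x) //= addrC addrK [X in _ - X](bigID (fun w => w != x)) /=.
  rewrite opprD addrA -sumrB.
  apply: (@le_trans _ _ (\sum_(w | w != x) (#|common x w|%:R - p0%:R))).
    by rewrite gerDl oppr_le0 sumr_ge0.
  apply: ler_sum => w _; rewrite sumr_const -[leRHS]mulr_natl.
  have [_|small] := leqP p0 #|common x w|; first by rewrite mulr1 gerBl.
  by rewrite mulr0 subr_le0 ler_nat ltnW.
have X_low c : 15 * d%:R <= 16 * X c by rewrite -!natrM ler_nat core_large.
have X_up c : X c <= d%:R by rewrite ler_nat card_core_le.
have d16 : 16 <= d%:R :> F by rewrite ler_nat.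
have sumX : #|B|%:R * (225 / 256 * d%:R ^+ 2 - d%:R) <= \sum_c X c ^+ 2 - \sum_c X c.
  rewrite -sumrB -[#|B|]sum1_card natr_sum mulr_suml; apply: ler_sum => c _.
  rewrite mul1r lerB //; have := X_low c; have := X_up c => u l.
  have : 0 <= (16 * X c - 15 * d%:R) * (16 * X c + 15 * d%:R).
    by rewrite mulr_ge0 // ?subr_ge0 // addr_ge0 // mulr_ge0 // ler0n.
  by lra.
have manyF : 16 * (p0%:R * (#|A|%:R * #|A|%:R)) <= #|B|%:R * d%:R ^+ 2 :> F.
  by rewrite expr2 -!natrM ler_nat mulnA.
have b0 : 0 <= #|B|%:R :> F by rewrite ler0n.
have bd : 16 * (#|B|%:R * d%:R) <= #|B|%:R * d%:R ^+ 2 :> F.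
  by rewrite mulrCA ler_wpM2l // expr2 ler_wpM2r // ler0n.
have -> : \sum_x \sum_(w | w != x) \sum_(c in common x w)
    ((7 / 8) * (p0 <= #|common x w|)%N%:R - 2 * (heavy c x w)%:R)
   = (7 / 8) * (\sum_x \sum_(w | w != x) \sum_(c in common x w) (p0 <= #|common x w|)%N%:R)
     - 2 * \sum_x \sum_(w | w != x) \sum_(c in common x w) (heavy c x w)%:R :> F.
  rewrite !mulr_sumr -sumrB; apply: eq_bigr => x _; rewrite !mulr_sumr -sumrB.
  by apply: eq_bigr => w _; rewrite !mulr_sumr -sumrB.
move: thick heavy_few sumX bd manyF; rewrite mulrBr expr2.
set T1 := \sum_x \sum_(w | _) _; set T2 := \sum_x \sum_(w | _) _.
set a2 := p0%:R * _; set S := \sum_c _ ^+ 2 - _.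
by have : 0 <= #|B|%:R * (d%:R * d%:R) :> F by [rewrite !mulr_ge0 ?ler0n]; lra.
Qed.

End Weights.

(** * The weight matrix and the contradiction *)

Section Core.
Variables (A B : finType) (G : A -> B -> bool) (k d s : nat).
Hypothesis k_ge4 : (4 <= k)%N.
Hypothesis no_strip : ~ has_strip G k.
Hypothesis d_ge16 : (16 <= d)%N.
Hypothesis regG : forall y, #|[set x | G x y]| = d.
Hypothesis s_upper : (s * s <= 4 * d)%N.
Local Notation F := rat.
Local Notation h := (2 * k)%N.
Local Notation L := (32 * h.+1)%N.
Local Notation p0 := (8 * (2 * L).+1)%N.
Local Notation kappa := ((2 * h + 1) + 4 * h.+1 * (L * L))%N.
Local Notation Q := (256 * k ^ 2)%N.
Variable Z : B -> {set B}.
Local Notation core := (core G s Z).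
Hypothesis core_large : forall c, (15 * d <= 16 * #|core c|)%N.
Hypothesis core_light : forall c z, z != c -> z \notin Z c ->
  (#|[set x | [&& G x c, (degree_in G (Z c) x < s)%N & G x z]]| < L * s)%N.
Hypothesis Z_self : forall c, c \notin Z c.
Hypothesis few_A : (16 * p0 * (#|A| * #|A|) <= #|B| * (d * d))%N.
Hypothesis few_B : (4 * (L * L) * kappa * (2 * L) ^ k * Q ^ k * #|B| <= d * d)%N.
Hypothesis B_gt0 : (0 < #|B|)%N.

Local Notation wt := (weight F G k s Z).
Let k_ge2 : (2 <= k)%N. Proof. by lia. Qed.

Let S : {set A * B} := [set q | q.1 \in core q.2].
Let n := #|S|.
Let st (i : 'I_n) : A * B := enum_val i.
Let M : 'M[F]_n := \matrix_(i, j) wt (st i).1 (st i).2 (st j).1 (st j).2.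

Let inS q : (q \in S) = (q.1 \in core q.2).
Proof. by rewrite in_set. Qed.

Let sum_st (f : A * B -> F) : \sum_i f (st i) = \sum_(q in S) f q.
Proof. by rewrite /st -big_enum_val. Qed.

Let sum_st_le (f : A * B -> F) : (forall q, 0 <= f q) -> \sum_i f (st i) <= \sum_x \sum_c f (x, c).
Proof.
move=> f0; rewrite sum_st pair_big /=; apply: le_trans (ler_sum_all _ f0) _.
by apply: ler_sum => -[].
Qed.

Let symM : M^T = M.
Proof. by apply/matrixP => i j; rewrite !mxE weight_sym. Qed.

Let M_ge0 i j : 0 <= M i j.
Proof. by rewrite mxE weight_ge0. Qed.

Let phi (i : 'I_n) : A := (st i).1.
Let psi (i : 'I_n) : B := (st i).2.

Let M_neq0 i j : M i j != 0 ->
  [/\ phi i != phi j, psi i != psi j, phi i \in core (psi j) & phi j \in core (psi i)].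
Proof.
by rewrite mxE => /weight_neq0[[? ? _ _ ?] [? _]].
Qed.

Let phi_proper i j : phi i = phi j -> M i j = 0.
Proof. by move=> e; apply/eqP; apply: contraT => /M_neq0[]; rewrite e eqxx. Qed.

Let psi_proper i j : psi i = psi j -> M i j = 0.
Proof. by move=> e; apply/eqP; apply: contraT => /M_neq0[_]; rewrite e eqxx. Qed.

Let row_le i : \sum_j M i j <= d%:R.
Proof.
under eq_bigr do rewrite mxE.
apply: le_trans (sum_st_le (f := fun q => wt (st i).1 (st i).2 q.1 q.2) _) _.
  by move=> q; apply: weight_ge0.
rewrite exchange_big /=; apply: le_trans (sum_mass_z F k s regG Z _ _) _.
by case: (_ \in _); rewrite ?mulr1 ?mulr0 ?ler0n.
Qed.

(** The first step is free and costs [d]; the second has to return to the label of the start. *)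
Let square_row_le (J : eqType) (f : 'I_n -> J) (r : F) :
  (forall l i, \sum_j (f i == f j)%:R * M l j <= r) -> 0 <= r ->
  forall i, \sum_j (f i == f j)%:R * (M ^+ 2) i j <= d%:R * r.
Proof.
move=> fr r0 i.
have -> : \sum_j (f i == f j)%:R * (M ^+ 2) i j
    = \sum_l M i l * \sum_j (f i == f j)%:R * M l j.
  under [RHS]eq_bigr do rewrite mulr_sumr.
  rewrite [RHS]exchange_big; apply: eq_bigr => j _.
  by rewrite expr2 mxE mulr_sumr; apply: eq_bigr => l _; rewrite mulrCA.
apply: (@le_trans _ _ (\sum_l M i l * r)).
  by apply: ler_sum => l _; rewrite ler_wpM2l.
by rewrite -mulr_suml ler_wpM2r.
Qed.

Let Dphi := label_square phi M.
Let Dpsi := label_square psi M.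

Let D_ge0 (K : finType) (f : 'I_n -> K) i j : 0 <= label_square f M i j.
Proof. by rewrite mxE mulr_ge0 // mxpow_ge0. Qed.

Let Dphi_row i : \sum_j Dphi i j <= d%:R.
Proof.
under eq_bigr do rewrite mxE.
rewrite -[d%:R]mulr1; apply: square_row_le => // l i'.
pose g (q : A * B) : F := (phi i' == q.1)%:R * wt (st l).1 (st l).2 q.1 q.2.
have -> : \sum_j (phi i' == phi j)%:R * M l j = \sum_j g (st j).
  by apply: eq_bigr => j _; rewrite mxE.
apply: le_trans (sum_st_le _) _ => [q|]; first by rewrite mulr_ge0 ?weight_ge0.
rewrite (bigD1 (phi i')) //= [X in _ + X]big1 ?addr0 => [|x /negbTE nx]; last first.
  by rewrite big1 // => c _; rewrite /g /= eq_sym nx mul0r.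
rewrite /g /= eqxx; under eq_bigr do rewrite mul1r.
apply: le_trans (sum_weight_z F G k s Z _ _ _) _.
by do 2![case: (_ \in _)]; rewrite ?mulr1 ?mulr0.
Qed.

Let Dpsi_row i : \sum_j Dpsi i j <= d%:R * (L * s)%:R.
Proof.
under eq_bigr do rewrite mxE.
apply: square_row_le => // l i'.
pose g (q : A * B) : F := (psi i' == q.2)%:R * wt (st l).1 (st l).2 q.1 q.2.
have -> : \sum_j (psi i' == psi j)%:R * M l j = \sum_j g (st j).
  by apply: eq_bigr => j _; rewrite mxE.
apply: le_trans (sum_st_le _) _ => [q|]; first by rewrite mulr_ge0 ?weight_ge0.
rewrite exchange_big (bigD1 (psi i')) //= [X in _ + X]big1 ?addr0 => [|x /negbTE nx]; last first.
  by rewrite big1 // => c _; rewrite /g /= eq_sym nx mul0r.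
rewrite /g /= eqxx; under eq_bigr do rewrite mul1r.
exact: (mass_le F core_light).
Qed.

(** Weights lie between [0] and [1], so a product of two is at most either factor, and its sum at
    most either mass. *)
Let Dpsi_le i j : Dpsi i j <= (psi i == psi j)%:R * overlap F G k s Z (psi i) (phi i) (phi j).
Proof.
rewrite mxE; case: eqP => [e|_]; last by rewrite !mul0r.
rewrite !mul1r expr2 mxE /overlap.
pose g (q : A * B) : F := wt (phi i) (psi i) q.1 q.2 * wt (phi j) (psi i) q.1 q.2.
have -> : \sum_l M i l * M l j = \sum_l g (st l).
  apply: eq_bigr => l _; rewrite !mxE /g -/(phi i) -/(psi i) -/(phi j) -/(psi j) -e.
  by rewrite [wt _ _ (phi j) _]weight_sym.
apply: le_trans (sum_st_le _) _ => [q|]; first by rewrite mulr_ge0 ?weight_ge0.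
rewrite exchange_big; apply: ler_sum => z _; rewrite /g le_min /=; apply/andP; split.
  by apply: ler_sum => w _; rewrite ler_piMr ?weight_ge0 ?weight_le1.
by apply: ler_sum => w _; rewrite ler_piMl ?weight_ge0 ?weight_le1.
Qed.

Let Dpsi_sq : \sum_i \sum_j Dpsi i j ^+ 2 <= #|B|%:R * (kappa%:R * d%:R ^+ 3).
Proof.
pose ov := overlap F G k s Z.
have ov0 c x y : 0 <= ov c x y.
  by apply: sumr_ge0 => z _; rewrite le_min !mass_ge0.
pose g (q r : A * B) : F := (q.2 == r.2)%:R * ov q.2 q.1 r.1 ^+ 2.
have g0 q r : 0 <= g q r by rewrite mulr_ge0 // sqr_ge0.
apply: (@le_trans _ _ (\sum_i \sum_j g (st i) (st j))).
  apply: ler_sum => i _; apply: ler_sum => j _.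
  have := Dpsi_le i j; rewrite /g -/(psi i) -/(psi j) -/(phi i) -/(phi j) -/ov => le1.
  apply: (@le_trans _ _ (((psi i == psi j)%:R * ov (psi i) (phi i) (phi j)) ^+ 2)).
    by rewrite lerXn2r ?nnegrE ?D_ge0 // mulr_ge0.
  by rewrite exprMn; case: (_ == _); rewrite ?expr1n ?expr0n.
apply: (@le_trans _ _ (\sum_i \sum_x \sum_c g (st i) (x, c))).
  by apply: ler_sum => i _; apply: (sum_st_le (f := g (st i))).
apply: (le_trans (sum_st_le (f := fun q => \sum_x \sum_c g q (x, c)) _)).
  by move=> q; apply: sumr_ge0 => x _; apply: sumr_ge0.
rewrite exchange_big -[#|B|]sum1_card natr_sum mulr_suml; apply: ler_sum => c _ /=.
rewrite mul1r; apply: le_trans (overlap_sq F k_ge2 no_strip regG s_upper core_light c).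
apply: ler_sum => x _; apply: ler_sum => y _.
rewrite (bigD1 c) //= /g /= eqxx mul1r big1 ?addr0 // => c' /negbTE nc.
by rewrite eq_sym nc mul0r.
Qed.

Let M_total : #|B|%:R * d%:R ^+ 2 / 4 <= \sum_i \sum_j M i j.
Proof.
apply: le_trans (total_weight F k_ge2 no_strip d_ge16 regG s_upper Z_self core_large few_A) _.
rewrite le_eqVlt; apply/orP; left; apply/eqP.
pose f q r := wt q.1 q.2 r.1 r.2.
transitivity (\sum_(q in S) \sum_(r in S) f q r); last first.
  by rewrite -sum_st; apply: eq_bigr => i _; rewrite -sum_st; apply: eq_bigr => j _; rewrite mxE.
have f0 q r : ~~ ((q \in S) && (r \in S)) -> f q r = 0.
  move=> nS; apply/eqP; apply: contraNT nS => /weight_neq0[[_ _ _ qS _] [_ rS]].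
  by rewrite !inS qS rS.
transitivity (\sum_q \sum_r f q r).
  rewrite pair_big; apply: eq_bigr => -[x c] _ /=; rewrite pair_big.
  by apply: eq_bigr => -[w z] _.
rewrite [RHS]big_mkcond; apply: eq_bigr => q _.
case qS: (q \in S); last by rewrite big1 // => r _; rewrite f0 // qS.
by rewrite [RHS]big_mkcond; apply: eq_bigr => r _; case rS: (r \in S); rewrite // f0 // rS andbF.
Qed.

Let n_le : (n <= #|B| * d)%N.
Proof.
rewrite /n -sum1_card (eq_bigl (fun q : A * B => q.1 \in core q.2)); last first.
  by move=> q; rewrite inS.
rewrite big_mkcond -(pair_big xpredT xpredT (fun x c => if x \in core c then 1%N else 0%N)) /=.
rewrite exchange_big -sum1_card big_distrl; apply: leq_sum => c _ /=.
rewrite -big_mkcond sum1_card mul1n; exact: card_core_le.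
Qed.

Lemma core_contradiction : False.
Proof.
have d0 : 0 < d%:R :> F by rewrite ltr0n; lia.
have b0 : 0 < #|B|%:R :> F by rewrite ltr0n.
have kpos : (0 < k)%N by apply: leq_trans k_ge4.
have tot0 : 0 < \sum_i \sum_j M i j.
  by apply: lt_le_trans M_total; rewrite !mulr_gt0 // exprn_gt0.
have n0 : (0 < n)%N.
  rewrite lt0n; apply: contraTneq tot0 => nz.
  rewrite big1 ?ltxx // => i _; suff : (i < 0)%N by [].
  by rewrite -nz; apply: ltn_ord.
have nF : 0 < n%:R :> F by rewrite ltr0n.
(* At most [#|B| d] states share a total weight of at least [#|B| d ^ 2 / 4], so the average row sum
   is at least [d / 4]. *)
have tr_ge : (d%:R / 4) ^+ (2 * k) <= \tr (M ^+ (2 * k)).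
  apply: le_trans (mxpow_trace_ge symM _ n0 tot0); last by [].
  rewrite lerXn2r ?nnegrE ?divr_ge0 ?(ltW d0) ?(ltW tot0) ?(ltW nF) //.
  rewrite ler_pdivlMr //; apply: le_trans M_total.
  have : n%:R <= #|B|%:R * d%:R :> F by rewrite -natrM ler_nat.
  by move/(ler_wpM2r (ltW d0)); rewrite expr2; lra.
pose e : F := (16 * k ^ 2)%N%:R^-1.
have k0 : 0 < (16 * k ^ 2)%N%:R :> F by rewrite ltr0n muln_gt0 expn_gt0 kpos.
have e0 : 0 < e by rewrite invr_gt0.
have tr0 : 0 < \tr (M ^+ (2 * k)).
  by apply: lt_le_trans tr_ge; rewrite exprn_gt0 // divr_gt0.
(* Here [Q] is [16] times [16 k ^ 2]: the first factor pays for the [4] in [d / 4], squared, the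
   second for [e]. *)
have enough (x : nat) : (Q ^ k * x <= d ^ (2 * k))%N -> x%:R <= e ^+ k * \tr (M ^+ (2 * k)).
  move=> Qx; apply: le_trans (ler_wpM2l (exprn_ge0 k (ltW e0)) tr_ge).
  have Q0 : 0 < (Q ^ k)%N%:R :> F by rewrite ltr0n expn_gt0 muln_gt0 expn_gt0 kpos.
  rewrite -(ler_pM2l Q0); apply: (@le_trans _ _ (d ^ (2 * k))%N%:R).
    by rewrite -natrM ler_nat.
  rewrite !natrX exprM mulrA -exprMn.
  rewrite [(d%:R / 4) ^+ (2 * k)]exprM -exprMn le_eqVlt; apply/orP; left; apply/eqP.
  congr (_ ^+ k); rewrite /e natrM natrX natrM natrX; field.
  by rewrite pnatr_eq0 -lt0n.
have few_d : (Q ^ k * #|B| <= d * d)%N.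
  apply: leq_trans few_B; rewrite leq_mul2r leq_pmull ?orbT //.
  by rewrite !muln_gt0 !expn_gt0 !muln_gt0 !addn_gt0 ?orbT.
have hphi : \tr (Dphi ^+ k) <= e ^+ k * \tr (M ^+ (2 * k)).
  apply: le_trans (mxpow_trace_le_card k (ltW d0) (D_ge0 phi) Dphi_row) _.
  rewrite -natrX -natrM; apply: enough.
  apply: (@leq_trans (Q ^ k * (#|B| * d * d ^ k))).
    by rewrite leq_mul2l leq_mul2r n_le !orbT.
  apply: (@leq_trans (d * d * (d * d ^ k))); first by rewrite -mulnA mulnA leq_mul2r few_d orbT.
  by rewrite mulnn -expnS -expnD leq_pexp2l //; move: k_ge4 d_ge16; clear; lia.
have hpsi : \tr (Dpsi ^+ k) <= e ^+ k * \tr (M ^+ (2 * k)).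
  have sD : Dpsi^T = Dpsi.
    have s2 : (M ^+ 2)^T = M ^+ 2 by apply: trmx_exp.
    have s2E i j : (M ^+ 2) j i = (M ^+ 2) i j by rewrite -{1}s2 mxE.
    by apply/matrixP => i j; rewrite [LHS]mxE [LHS]mxE [RHS]mxE eq_sym s2E.
  have r0 : 0 <= d%:R * (L * s)%:R :> F by rewrite mulr_ge0.
  have := mxpow_trace_le (k - 2) sD r0 (D_ge0 psi) Dpsi_row.
  rewrite (_ : (k - 2).+2 = k); last by move: k_ge4; clear; lia.
  move/le_trans; apply.
  apply: (le_trans (ler_wpM2l (exprn_ge0 _ r0) Dpsi_sq)).
  rewrite -natrM -!natrX -!natrM; apply: enough.
  have sd : (s <= 2 * d)%N by move: s_upper; clear; nia.
  (* Two factors [d * (L * s)] are estimated by [s ^ 2 <= 4 d], which gives [d ^ 3] together; the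
     crude [s <= 2 d] suffices for the others. Two such factors exist because [4 <= k]. *)
  have -> : (k - 2 = 2 + (k - 4))%N by move: k_ge4; clear; lia.
  rewrite expnD.
  have s1 : ((d * (L * s)) ^ 2 <= d * d * (L * L) * (4 * d))%N.
    have -> (l : nat) : ((d * (l * s)) ^ 2 = d * d * (l * l) * (s * s))%N by ring.
    by rewrite leq_mul2l s_upper orbT.
  have s2 : ((d * (L * s)) ^ (k - 4) <= (2 * L) ^ k * (d ^ 2) ^ (k - 4))%N.
    apply: (@leq_trans ((2 * L) ^ (k - 4) * (d ^ 2) ^ (k - 4))).
      rewrite -expnMn; have [->|k4] := posnP (k - 4)%N; first by rewrite !expn0.
      rewrite leq_exp2r //.
      have -> (l : nat) : (2 * l * d ^ 2 = d * (l * (2 * d)))%N by ring.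
      by rewrite !leq_mul2l sd !orbT.
    by rewrite leq_mul2r leq_pexp2l ?orbT // leq_subr.
  apply: (@leq_trans (Q ^ k * ((d * d * (L * L) * (4 * d)) * ((2 * L) ^ k * (d ^ 2) ^ (k - 4))
      * (#|B| * (kappa * d ^ 3))))).
    by rewrite leq_mul2l leq_mul2r leq_mul ?orbT.
  apply: (@leq_trans (d * d * (d ^ 6 * (d ^ 2) ^ (k - 4)))); last first.
    by rewrite -expnM mulnn -!expnD leq_pexp2l //; move: k_ge4 d_ge16; clear; lia.
  apply: (@leq_trans ((4 * (L * L) * kappa * (2 * L) ^ k * Q ^ k * #|B|) * (d ^ 6 * (d ^ 2) ^ (k - 4)))).
    move: (L * L)%N ((2 * L) ^ k)%N (Q ^ k)%N kappa ((d ^ 2) ^ (k - 4))%N => l2 lk q kp dk.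
    by apply: eq_leq; ring.
  by rewrite leq_mul2r few_B orbT.
have k2 : (2 <= k)%N by apply: leq_trans k_ge4.
have e1 : e * (16 * k ^ 2)%N%:R <= 1 by rewrite /e mulVf // gt_eqF.
have [i [t [closed steps ndphi ndpsi]]] :=
  noncolliding_closed_walk symM M_ge0 phi_proper psi_proper k2 e0 e1 tr0 hphi hpsi.
set w := nth i (i :: t) in closed steps ndphi ndpsi.
(* The states of the walk are the rungs [u a], [v a]; the 4-cycle of each step supplies the two
   remaining adjacencies. *)
apply: no_strip; exists (phi \o w), (psi \o w); split; [exact: ndphi|exact: ndpsi|].
move=> a ak; have wS : w (a.+1 %% (2 * k))%N = w a.+1.
  have [->|ne] := eqVneq a.+1 (2 * k)%N; first by rewrite modnn closed.
  by rewrite modn_small // ltn_neqAle ne.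
rewrite /= wS; have [_ _ c1 c2] := M_neq0 (steps a ak).
have c0 : phi (w a) \in core (psi (w a)) by rewrite -inS; apply: enum_valP.
by rewrite !(core_adj (s := s) (Z := Z)).
Qed.

End Core.

Close Scope ring_scope.

(** * The upper bound *)

Theorem regular_strip (k : nat) : 4 <= k -> exists C1 C2 : nat, 0 < C2 /\
  forall (A B : finType) (G : A -> B -> bool) (d : nat),
    0 < #|B| -> (forall y, #|[set x | G x y]| = d) ->
    C1 * (#|A| * #|A|) <= #|B| * (d * d) -> C2 * #|B| <= d * d -> ~ ~ has_strip G k.
Proof.
move=> k4; set h := 2 * k; set L := 32 * h.+1.
exists (16 * (8 * (2 * L).+1)).
set C2 := 4 * (L * L) * (2 * h + 1 + 4 * h.+1 * (L * L)) * (2 * L) ^ k * (256 * k ^ 2) ^ k.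
(* The added [256] forces [16 <= d]. *)
exists (C2 + 256); split; first by rewrite addn_gt0 orbT.
move=> A B G d B0 regG fewA fewB no_strip.
have d16 : 16 <= d.
  have : 256 <= d * d by apply: leq_trans fewB; rewrite mulnDl; move: (C2 * _) B0; clear; lia.
  by clear; nia.
have [s /andP[s1 s2]] := @approx_sqrt d (leq_trans (isT : 0 < 16) d16).
have k2 : 2 <= k by apply: leq_trans k4.
have d0 : 0 < d by apply: leq_trans d16.
have [Z ZP] := fin_all_exists (heavy_set rat k2 no_strip d0 regG s1).
apply: (@core_contradiction A B G k d s k4 no_strip d16 regG s2 Z) => //.
- by move=> c; have [] := ZP c.
- by move=> c z zc zZ; have [_ _ /(_ z zc zZ)] := ZP c.
- by move=> c; have [] := ZP c.
by apply: leq_trans fewB; rewrite leq_mul2r leq_addr orbT.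
Qed.

(** * Bipartite subgraphs with half of the edges *)

Section Cut.
Variables (T : eqType).
Implicit Types (r : rel T) (s : seq T).

Fixpoint pair_count r s : nat := if s is v :: s' then pair_count r s' + count (r v) s' else 0.

Lemma pair_count_sum r s : symmetric r -> irreflexive r ->
  2 * pair_count r s = \sum_(x <- s) \sum_(y <- s) r x y.
Proof.
move=> rs ri; elim: s => [|v s IH] /=; first by rewrite big_nil.
rewrite 2!big_cons ri add0n.
have -> : \sum_(x <- s) \sum_(y <- v :: s) r x y = \sum_(x <- s) (r v x + \sum_(y <- s) r x y).
  by apply: eq_bigr => x _; rewrite big_cons rs.
rewrite big_split /= -IH -sum1_count.
have -> : \sum_(y <- s) r v y = \sum_(y <- s | r v y) 1.
  by rewrite [RHS]big_mkcond; apply: eq_bigr => y _; case: (r v y).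
by lia.
Qed.

(** Greedy: each vertex joins the side that cuts at least half of its edges to the vertices already
    placed. *)
Lemma exists_cut r s : uniq s ->
  exists S : T -> bool, pair_count r s <= 2 * pair_count (fun x y => r x y && (S x != S y)) s.
Proof.
elim: s => [|v s IH] /=; first by exists xpredT.
case/andP => vs /IH[S HS].
pose a b := count (fun y => r v y && (b != S y)) s.
have ab : count (r v) s = a true + a false.
  rewrite /a; elim: (s) => //= y s' ->; by case: (r v y); case: (S y) => /=; lia.
pose b := a false <= a true; exists (fun x => if x == v then b else S x).
have -> : pair_count (fun x y => r x y && ((if x == v then b else S x) != (if y == v then b else S y))) s
    = pair_count (fun x y => r x y && (S x != S y)) s.
  elim: (s) vs => //= y s' IHs; rewrite inE negb_or => /andP[vy vs'].
  rewrite IHs // eq_sym (negbTE vy); congr (_ + _); apply: eq_in_count => z zs'.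
  by have -> : (z == v) = false by [apply/negbTE; apply: contraNneq vs' => <-].
rewrite eqxx ab.
have -> : count (fun y => r v y && (b != (if y == v then b else S y))) s = a b.
  apply: eq_in_count => z zs.
  by have -> : (z == v) = false by [apply/negbTE; apply: contraNneq vs => <-].
rewrite mulnDr; apply: (leq_add HS); rewrite /b.
have [] := leqP (a false) (a true); move: (a true) (a false); clear; lia.
Qed.

End Cut.

(** * From strips to prisms *)

Section Embedding.
Variables (n l : nat) (E : {set {set 'I_n}}).

(* The strip vertices [u i], [v i] are [a_i], [b_i] for even [i] and [b_i], [a_i] for odd [i]. *)
Lemma copy_of_strip (B : finType) (G : 'I_n -> B -> bool) (emb : B -> 'I_n) (S : pred 'I_n) :
  injective emb -> (forall x y, G x y -> [/\ S x, ~~ S (emb y) & [set x; emb y] \in E]) ->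
  has_strip G l -> contains_copy (@prism_adj l) E.
Proof.
move=> injemb GE [u [v [injU injV adj]]].
have injU' i j : i < 2 * l -> j < 2 * l -> u i = u j -> i = j.
  move=> il jl e; case: (ltngtP i j) => // ij; first by case: (injU i j) => //; rewrite ij.
  by case: (injU j i) => //; rewrite ij.
have injV' i j : i < 2 * l -> j < 2 * l -> v i = v j -> i = j.
  move=> il jl e; case: (ltngtP i j) => // ij; first by case: (injV i j) => //; rewrite ij.
  by case: (injV j i) => //; rewrite ij.
have SU i : i < 2 * l -> S (u i) by move=> /adj/and3P[/GE[]].
have SV i : i < 2 * l -> ~~ S (emb (v i)) by move=> /adj/and3P[/GE[]].
pose f := [ffun p : 'I_(2 * l) * bool => if odd p.1 == p.2 then u p.1 else emb (v p.1)].
apply/existsP; exists f; apply/andP; split.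
  apply/injectiveP => -[i a] [j b]; rewrite !ffunE /=.
  case: eqP => ea; case: eqP => eb e.
  - by have ij := injU' _ _ (ltn_ord i) (ltn_ord j) e; rewrite -ea -eb ij (ord_inj ij).
  - by have := SU _ (ltn_ord i); rewrite e (negbTE (SV _ (ltn_ord j))).
  - by have := SU _ (ltn_ord j); rewrite -e (negbTE (SV _ (ltn_ord i))).
  - have ij := injV' _ _ (ltn_ord i) (ltn_ord j) (injemb _ _ e).
    congr pair; first exact: ord_inj.
    by move: ea eb; rewrite ij; case: a; case: b; case: (odd j).
(* The cycle length is even, so parity still alternates across the wrap-around. *)
have wrap i : i < 2 * l -> odd (i.+1 %% (2 * l)) = ~~ odd i.
  move=> il; have [e|ne] := eqVneq i.+1 (2 * l); last by rewrite modn_small // ltn_neqAle ne.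
  by rewrite -oddS e modnn oddM.
pose g a j := if odd j == a then u j else emb (v j).
have step i a : i < 2 * l -> [set g a i; g a (i.+1 %% (2 * l))] \in E.
  move=> il; have /and3P[_ /GE[_ _ e1] /GE[_ _ e2]] := adj i il.
  rewrite /g wrap //; move: e1 e2; case: (odd i); case: (a) => //= e1 e2; by rewrite setUC.
have rung i : i < 2 * l -> [set u i; emb (v i)] \in E.
  by move=> il; have /and3P[/GE[_ _ e] _ _] := adj i il.
apply/forallP => -[i a]; apply/forallP => -[j b]; apply/implyP; rewrite /prism_adj !ffunE /=.
case/orP => [/andP[/eqP <- /orP[/eqP ij|/eqP ji]]|/andP[/eqP <- ab]].
- by rewrite -ij; apply: (step i a).
- by rewrite -ji setUC; apply: (step j a).
have := rung i (ltn_ord i); move: ab; case: (a); case: (b); case: (odd i) => //= _ e; by rewrite setUC.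
Qed.

End Embedding.

(** * Reduction to one-sided regular bipartite graphs *)

Lemma sum_threshold (T : finType) (f : T -> nat) (m : nat) : (forall y, f y <= m) ->
  \sum_y f y = \sum_(1 <= t < m.+1) #|[set y | t <= f y]|.
Proof.
move=> fm; rewrite (eq_bigr (fun y => \sum_(1 <= t < m.+1) (t <= f y))).
  rewrite exchange_big; apply: eq_bigr => t _ /=.
  by rewrite -sum1_card [RHS]big_mkcond; apply: eq_bigr => y _; rewrite inE.
move=> y _; rewrite (@big_cat_nat _ _ _ (f y).+1) //= ?ltnS ?fm //.
rewrite (eq_big_nat _ _ (F2 := fun=> 1)) => [|t /andP[_ ty]]; last by rewrite -ltnS ty.
rewrite [X in _ + X](eq_big_nat _ _ (F2 := fun=> 0)) => [|t /andP[yt _]]; last first.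
  by rewrite leqNgt yt.
by rewrite !sum_nat_const_nat muln0 muln1 addn0 subn1.
Qed.

(* Otherwise [N_t <= C1 m^2 / t^2] for all [t > t0], and the sum of [1 / t^2] telescopes. *)
Lemma exists_threshold (T : finType) (f : T -> nat) (m C1 C2 t0 : nat) :
    (forall y, f y <= m) -> #|T| <= m -> 0 < t0 -> 0 < C2 ->
    C2 * m <= t0 * t0 -> t0 * t0 * m + C1 * (m * m) < t0 * \sum_y f y ->
  exists t, let b := #|[set y | t <= f y]| in
    [/\ 0 < b, C1 * (m * m) <= b * (t * t) & C2 * b <= t * t].
Proof.
move=> fm Tm t00 C20 C2m dense; pose N t := #|[set y | t <= f y]|.
have [/existsP[t /andP[tt0 /andP[Nt ineq]]]|none] := boolP [exists t : 'I_m.+1,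
   (t0 <= t) && ((0 < N t) && (C1 * (m * m) <= N t * (t * t)))].
  exists t; split=> //; apply: (@leq_trans (C2 * m)).
    by rewrite leq_mul2l (leq_trans (max_card _) Tm) orbT.
  by apply: leq_trans C2m _; apply: leq_mul.
exfalso; have small t : t0 <= t -> t <= m -> N t * (t * t) <= C1 * (m * m).
  move=> tt0 tm; move: none; rewrite negb_exists => /forallP/(_ (Ordinal (tm : t < m.+1))) /=.
  rewrite tt0 /= negb_and -eqn0Ngt -ltnNge => /orP[/eqP->|/ltnW] //.
move: dense; rewrite (sum_threshold fm) ltnNge => /negP; apply.
have Nm t : N t <= m by apply: leq_trans (max_card _) Tm.
have [mt0|t0m] := leqP m t0.
  apply: leq_trans (leq_addr _ _); rewrite -mulnA leq_mul2l.
  apply/orP; right; apply: (@leq_trans (\sum_(1 <= t < m.+1) m)); first by apply: leq_sum => t _; apply: Nm.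
  by rewrite sum_nat_const_nat subn1 /= leq_mul2r mt0 orbT.
rewrite (@big_cat_nat _ _ _ t0.+1) //= ?ltnS ?(ltnW t0m) // mulnDr.
apply: leq_add.
  rewrite -mulnA leq_mul2l; apply/orP; right.
  apply: (@leq_trans (\sum_(1 <= t < t0.+1) m)); first by apply: leq_sum => t _; apply: Nm.
  by rewrite sum_nat_const_nat subn1.
rewrite -(ler_nat rat) natrM natr_sum.
set X := (C1 * (m * m))%:R%R.
suff tele q : t0 <= q -> q <= m ->
    (t0%:R * \sum_(t0.+1 <= t < q.+1) (N t)%:R <= X * (1 - t0%:R / q%:R) :> rat)%R.
  apply: le_trans (tele m (ltnW t0m) (leqnn m)) _.
  by rewrite ler_piMr ?ler0n // lerBlDr lerDl divr_ge0 ?ler0n.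
elim: q => [|q IH] qt qm; first by lia.
have [e|ne] := eqVneq q.+1 t0.
  by rewrite e big_geq // mulr0 divff ?pnatr_eq0 -?lt0n // subrr mulr0.
have tq : t0 <= q by lia.
have le1 := IH tq (ltnW qm); rewrite (@big_nat_recr _ _ _ q.+1 t0.+1) //= mulrDr.
have q0 : (0 < q%:R :> rat)%R by rewrite ltr0n; lia.
have q1 : (0 < q.+1%:R :> rat)%R by rewrite ltr0n.
have t0R : (0 < t0%:R :> rat)%R by rewrite ltr0n.
have := small q.+1 qt qm; rewrite -(ler_nat rat) -/X [(N _ * _)%:R%R]natrM natrM => sm.
have {}sm : ((N q.+1)%:R * (q.+1%:R * q%:R) <= X)%R.
  apply: le_trans sm; rewrite /= !ler_wpM2l ?ler0n // ler_nat //.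
have : (t0%:R * (N q.+1)%:R <= X * (t0%:R / q%:R - t0%:R / q.+1%:R))%R.
  have -> : (t0%:R / q%:R - t0%:R / q.+1%:R = t0%:R / (q.+1%:R * q%:R) :> rat)%R.
    rewrite -natr1 in q1 *; field; rewrite !gt_eqF //.
  by rewrite mulrCA ler_wpM2l ?ler0n // ler_pdivlMr // mulr_gt0.
move: le1; set a := (t0%:R / q%:R)%R; set b := (t0%:R / q.+1%:R)%R => le1.
rewrite mulrBr => le2; apply: le_trans (lerD le1 le2) _; rewrite -mulrBr -mulrDr.
by rewrite addrA subrK.
Qed.

Theorem prism_free_edges (l : nat) : 4 <= l -> exists C : nat,
  forall (n : nat) (E : {set {set 'I_n}}), simple_graph E ->
    ~~ contains_copy (@prism_adj l) E -> #|E| ^ 2 <= C * n ^ 3.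
Proof.
move=> l4; have [C1 [C2 [C20 strip]]] := regular_strip l4.
(* The [16] is the square of the factor [4] lost in passing from [#|E|] to the cut; [4 * C2 + C1] is
   the density that [exists_threshold] requires for [t0 ^ 2 <= 4 * C2 * n]. *)
exists (16 * (4 * C2 + C1) ^ 2) => n E simE noE.
pose adj (x y : 'I_n) := [set x; y] \in E.
have adj_sym : symmetric adj by move=> x y; rewrite /adj setUC.
have adj_irr : irreflexive adj.
  move=> x; apply/negP => xE; have /forall_inP/(_ _ xE) := simE.
  by rewrite setUid cards1.
have E_le : #|E| <= \sum_x \sum_y adj x y.
  have sub : E \subset [set [set q.1; q.2] | q in [set q : 'I_n * 'I_n | adj q.1 q.2]].
    apply/subsetP => e eE; have /forall_inP/(_ _ eE)/cards2P[x [y [_ exy]]] := simE.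
    by apply/imsetP; exists (x, y); rewrite ?inE /adj -?exy.
  apply: leq_trans (subset_leq_card sub) _; apply: leq_trans (leq_imset_card _ _) _.
  rewrite -sum1_card big_mkcond pair_big; apply: leq_sum => q _.
  by rewrite inE; case: (adj _ _).
have [S HS] := exists_cut adj (enum_uniq 'I_n).
pose G0 x y := [&& S x, ~~ S y & adj x y].
pose deg y := #|[set x | G0 x y]|.
set e0 := \sum_y deg y.
have E_e0 : #|E| <= 4 * e0.
  pose cadj x y := adj x y && (S x != S y).
  have cadj_sym : symmetric cadj by move=> x y; rewrite /cadj adj_sym eq_sym.
  have cadj_irr : irreflexive cadj by move=> x; rewrite /cadj adj_irr.
  have s1 := pair_count_sum (enum 'I_n) adj_sym adj_irr.
  have s2 := pair_count_sum (enum 'I_n) cadj_sym cadj_irr.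
  have s3 : \sum_x \sum_y cadj x y = 2 * e0.
    have e0E : e0 = \sum_x \sum_y G0 x y.
      rewrite exchange_big; apply: eq_bigr => y _; rewrite /deg -sum1_card big_mkcond.
      by apply: eq_bigr => x _; rewrite inE; case: (G0 x y).
    rewrite mul2n -addnn {1}e0E e0E [X in _ + X]exchange_big -big_split; apply: eq_bigr => x _ /=.
    rewrite -big_split; apply: eq_bigr => y _ /=; rewrite /cadj /G0 [adj y x]adj_sym.
    by case: (S x); case: (S y); case: (adj x y).
  have all_pairs (r : rel 'I_n) : \sum_(x <- enum 'I_n) \sum_(y <- enum 'I_n) r x y = \sum_x \sum_y r x y.
    by rewrite big_enum; apply: eq_bigr => x _; rewrite big_enum.
  have {}HS : pair_count adj (enum 'I_n) <= 2 * pair_count cadj (enum 'I_n) := HS.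
  rewrite all_pairs in s1; rewrite all_pairs s3 in s2; rewrite -s1 in E_le.
  move: (pair_count adj _) (pair_count cadj _) s2 E_le HS => a b; clear; lia.
have [few|many] := leqP (e0 ^ 2) ((4 * C2 + C1) ^ 2 * n ^ 3).
  apply: leq_trans (_ : (4 * e0) ^ 2 <= _); first by rewrite leq_exp2r.
  by rewrite expnMn -mulnA leq_mul2l few orbT.
exfalso; have n0 : 0 < n.
  rewrite lt0n; apply/eqP => n0; move: many; rewrite /e0 big1 ?ltn0 // => y _.
  by have := ltn_ord y; rewrite {2}n0.
have [t0 /andP[t0l t0u]] : exists t0, C2 * n <= t0 * t0 <= 4 * (C2 * n).
  by apply: approx_sqrt; rewrite muln_gt0 C20.
have t00 : 0 < t0.
  by rewrite lt0n; apply/eqP => e; move: t0l; rewrite e leqn0 muln_eq0 !gtn_eqF.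
have dense : t0 * t0 * n + C1 * (n * n) < t0 * e0.
  apply: (@leq_ltn_trans ((4 * C2 + C1) * (n * n))).
    rewrite mulnDl leq_add2r; apply: (@leq_trans (4 * (C2 * n) * n)); first by rewrite leq_mul2r t0u orbT.
    by rewrite !mulnA.
  rewrite -(@ltn_exp2r _ _ 2) //.
  apply: (@leq_ltn_trans (C2 * n * ((4 * C2 + C1) ^ 2 * n ^ 3))).
    rewrite expnMn (_ : (n * n) ^ 2 = n * n ^ 3); last by ring.
    have -> (q : nat) : C2 * n * (q * n ^ 3) = C2 * (q * (n * n ^ 3)) by ring.
    by rewrite leq_pmull.
  apply: (@leq_ltn_trans (t0 * t0 * ((4 * C2 + C1) ^ 2 * n ^ 3))); first by rewrite leq_mul2r t0l orbT.
  by rewrite expnMn mulnn ltn_pmul2l // expn_gt0 t00.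
have deg_le y : deg y <= n by rewrite -[leqRHS]card_ord max_card.
have cardn : #|'I_n| <= n by rewrite card_ord.
have [t [b0 bA bB]] := exists_threshold deg_le cardn t00 C20 t0l dense.
(* Each vertex of degree at least [t] keeps exactly [t] neighbours, which makes this side
   regular. *)
pose B := {y : 'I_n | t <= deg y}.
have cardB : #|{: B}| = #|[set y | t <= deg y]|.
  by rewrite card_sig; apply: eq_card => y; rewrite !inE.
have [R RP] : exists R : B -> {set 'I_n}, forall y,
    R y \subset [set x | G0 x (val y)] /\ #|R y| = t.
  apply: (fin_all_exists (P := fun (y : B) (X : {set 'I_n}) =>
    X \subset [set x | G0 x (val y)] /\ #|X| = t)) => y.
  by have [X XS Xt] := subset_of_card (valP y); exists X.
apply: (strip _ _ (fun x (y : B) => x \in R y) t).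
- by rewrite cardB.
- by move=> y; have [_ <-] := RP y; apply: eq_card => x; rewrite inE.
- by rewrite cardB card_ord.
- by rewrite cardB.
move=> hs; move/negP: noE; apply.
apply: (copy_of_strip (emb := val) (S := S) _ _ hs); first exact: val_inj.
move=> x y xR; have [/subsetP/(_ x xR)] := RP y; rewrite inE => /and3P[Sx Sy xy] _.
by split.
Qed.

(** * The lower bound *)

Section Incidence.
Variables (F : finFieldType) (n : nat).
Hypothesis room : 2 * #|F| ^ 2 <= n.

Let V : finType := ((F * F) + (F * F))%type.

Let cardV : #|{: V}| <= n.
Proof. by rewrite card_sum !card_prod addnn -mul2n mulnn. Qed.

Let pos (v : V) : 'I_n := widen_ord cardV (enum_rank v).

Let pos_inj : injective pos.
Proof.
by move=> v w /(congr1 val) /= e; apply: enum_rank_inj; apply: val_inj.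
Qed.

(* The point [(x, m x + c)] lies on the line [(m, c)], of equation [y = m x + c]. *)
Definition incidence_edge (t : F * (F * F)) : {set 'I_n} :=
  [set pos (inl (t.1, t.2.1 * t.1 + t.2.2)%R); pos (inr t.2)].

Definition incidence_graph : {set {set 'I_n}} := [set incidence_edge t | t : F * (F * F)].

Lemma incidence_graph_simple : simple_graph incidence_graph.
Proof.
apply/forall_inP => e /imsetP[t _ ->]; rewrite cards2 (inj_eq pos_inj).
by [].
Qed.

Lemma incidence_edgeP a b : [set a; b] \in incidence_graph ->
  exists p r, p.2 = (r.1 * p.1 + r.2)%R /\
    ((a = pos (inl p) /\ b = pos (inr r)) \/ (a = pos (inr r) /\ b = pos (inl p))).
Proof.
case/imsetP => -[x r] _ e; exists (x, (r.1 * x + r.2)%R), r; split=> //.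
have ain : a \in incidence_edge (x, r) by rewrite -e !inE eqxx.
have bin : b \in incidence_edge (x, r) by rewrite -e !inE eqxx orbT.
have pin : pos (inl (x, (r.1 * x + r.2)%R)) \in [set a; b] by rewrite e !inE eqxx.
have rin : pos (inr r) \in [set a; b] by rewrite e !inE eqxx orbT.
move: ain bin pin rin; rewrite !inE /=.
case/orP => /eqP ->; case/orP => /eqP ->; rewrite !(inj_eq pos_inj) //=.
- by left.
by right.
Qed.

Lemma card_incidence_graph : #|incidence_graph| = #|F| ^ 3.
Proof.
rewrite card_imset; first by rewrite !card_prod !expnS expn0 muln1.
move=> [x r] [y s] e.
have : pos (inr r) \in incidence_edge (y, s) by rewrite -e !inE eqxx orbT.
have : pos (inl (x, (r.1 * x + r.2)%R)) \in incidence_edge (y, s) by rewrite -e !inE eqxx.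
rewrite !inE /= !(inj_eq pos_inj) /= orbF => /eqP[-> _] /eqP[->].
by [].
Qed.

Lemma two_points_one_line (p p' r r' : F * F) :
  p.2 = (r.1 * p.1 + r.2)%R -> p'.2 = (r.1 * p'.1 + r.2)%R ->
  p.2 = (r'.1 * p.1 + r'.2)%R -> p'.2 = (r'.1 * p'.1 + r'.2)%R -> p = p' \/ r = r'.
Proof.
case: p p' r r' => [x y] [x' y'] [m c] [m' c'] /= h1 h2 h3 h4.
have [e|xx] := eqVneq x x'; first by left; rewrite h1 h2 e.
right; have mm : m = m'.
  apply/eqP; rewrite -subr_eq0.
  have : ((m - m') * (x - x') == 0)%R.
    apply/eqP; transitivity ((m * x + c - (m' * x + c')) - (m * x' + c - (m' * x' + c')))%R.
      by ring.
    by rewrite -h1 -h2 -h3 -h4 !subrr.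
  by rewrite mulf_eq0 [(x - x' == 0)%R]subr_eq0 (negbTE xx) orbF.
have cc : c = c' by apply: (@addrI _ (m * x)%R); rewrite -h1 {1}mm.
by rewrite mm cc.
Qed.

Lemma incidence_graph_no_square (w0 w1 w2 w3 : 'I_n) :
  [set w0; w1] \in incidence_graph -> [set w1; w2] \in incidence_graph ->
  [set w2; w3] \in incidence_graph -> [set w3; w0] \in incidence_graph ->
  w0 = w2 \/ w1 = w3.
Proof.
move=> /incidence_edgeP[p0 [r0 [i0 e0]]] /incidence_edgeP[p1 [r1 [i1 e1]]].
move=> /incidence_edgeP[p2 [r2 [i2 e2]]] /incidence_edgeP[p3 [r3 [i3 e3]]].
(* Points and lines alternate along the walk, so two of the sixteen cases survive: [w0] is a point
   or [w0] is a line. *)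
case: e0 => -[a0 b0]; case: e1 => -[a1 b1]; case: e2 => -[a2 b2]; case: e3 => -[a3 b3];
  try (by move: b0; rewrite a1 => /pos_inj);
  try (by move: b1; rewrite a2 => /pos_inj);
  try (by move: b2; rewrite a3 => /pos_inj).
- move: b0 b1 b2 b3; rewrite a1 a2 a3 a0.
  move=> /pos_inj[q0] /pos_inj[q1] /pos_inj[q2] /pos_inj[q3]; subst.
  have [->|->] := two_points_one_line i0 i1 i3 i2; by [left|right].
- move: b0 b1 b2 b3; rewrite a1 a2 a3 a0.
  move=> /pos_inj[q0] /pos_inj[q1] /pos_inj[q2] /pos_inj[q3]; subst.
  by have [->|->] := two_points_one_line i1 i2 i0 i3; [right|left].
Qed.

(** Two consecutive rungs of the prism span a 4-cycle. *)
Lemma incidence_graph_prism_free l : 2 <= l -> ~~ contains_copy (@prism_adj l) incidence_graph.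
Proof.
move=> l2; apply/negP => /existsP[f /andP[/injectiveP injf /forallP edges]].
have l0 : 0 < 2 * l by lia.
have l1 : 1 < 2 * l by lia.
have l3 : 2 < 2 * l by lia.
have edge p q : prism_adj p q -> [set f p; f q] \in incidence_graph.
  by move=> pq; have /forallP/(_ q) := edges p; rewrite pq.
pose v i b : 'I_(2 * l) * bool := (i, b).
pose i0 := Ordinal l0; pose i1 := Ordinal l1.
have := @incidence_graph_no_square (f (v i0 false)) (f (v i1 false)) (f (v i1 true)) (f (v i0 true)).
case; rewrite ?edge // /prism_adj /= ?modn_small //.
- by move=> /injf.
- by move=> /injf.
Qed.

End Incidence.

(** The field has order [2 ^ j] with [4 ^ j] the largest power of four up to [n./2]. Then
    [n < 8 * 4 ^ j], whence [512 = 8 ^ 3], and [8 <= n] makes [j] positive. *)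
Theorem many_prism_free_edges (l n : nat) : 2 <= l -> 8 <= n ->
  n ^ 3 <= 512 * ex (@prism_adj l) n ^ 2.
Proof.
move=> l2 n8; pose j := trunc_log 4 n./2.
have /andP[jl ju] : 4 ^ j <= n./2 < 4 ^ j.+1 by apply: trunc_log_bounds => //; lia.
have j0 : 0 < j by rewrite /j lt0n; apply/eqP => e; move: ju; rewrite /j e; lia.
have [F _ Fcard] := PrimePowerField (isT : prime 2) j0.
have q2 : #|F| ^ 2 = 4 ^ j by rewrite Fcard -expnM mulnC expnM.
have room : 2 * #|F| ^ 2 <= n by rewrite q2; lia.
apply: (@leq_trans (512 * (#|F| ^ 3) ^ 2)).
  rewrite -expnM (_ : 3 * 2 = 2 * 3) // expnM q2; rewrite (_ : 512 = 8 ^ 3) // mulnC -expnMn leq_exp2r //.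
  by move: ju; rewrite expnS; lia.
rewrite leq_mul2l leq_exp2r // -(card_incidence_graph room) /ex.
apply: (leq_bigmax_cond (F := fun E : {set {set 'I_n}} => #|E|)).
by rewrite incidence_graph_simple incidence_graph_prism_free.
Qed.

(** * Passage to real exponents *)

Import Reals Lra.

Lemma Rpower_three_halves_sq (n : nat) : (0 < n)%N ->
  (Rpower (INR n) (3 / 2) * Rpower (INR n) (3 / 2) = INR (expn n 3))%R.
Proof.
move=> n0; have np : (0 < INR n)%R by apply: lt_0_INR; apply/ssrnat.ltP.
rewrite -Rpower_plus (_ : (3 / 2 + 3 / 2)%R = INR 3); last by rewrite /=; field.
rewrite Rpower_pow // !expnS expn0 !mult_INR /=; ring.
Qed.

(** The crude bound [K <= (K + 1) ^ 2] replaces a square root. *)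
Lemma sqrt_bound (a b : R) (K : nat) : (0 <= a)%R -> (0 <= b)%R ->
  (a * a <= INR K * (b * b))%R -> (a <= INR K.+1 * b)%R.
Proof.
move=> a0 b0 ab; have K0 := pos_INR K; rewrite S_INR.
apply: Rnot_lt_le => lt.
have b1 : (0 <= (INR K + 1) * b)%R by apply: Rmult_le_pos; Lra.lra.
have : ((INR K + 1) * b * ((INR K + 1) * b) < a * a)%R by apply: Rmult_le_0_lt_compat.
have : (0 <= (INR K * INR K + INR K + 1) * (b * b))%R.
  apply: Rmult_le_pos; last exact: Rle_0_sqr.
  by have := Rle_0_sqr (INR K); rewrite /Rsqr; Lra.lra.
Lra.lra.
Qed.

Theorem theorem1p1 :
  forall l : nat, (4 <= l)%N ->
  exists c C : R, (0 < c)%R /\ (0 < C)%R /\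
    exists N : nat, forall n : nat, (N <= n)%N ->
      (c * Rpower (INR n) (3 / 2) <= INR (ex (@prism_adj l) n))%R /\
      (INR (ex (@prism_adj l) n) <= C * Rpower (INR n) (3 / 2))%R.
Proof.
move=> l l4; have [K upper] := prism_free_edges l4.
(* Both constants come from [sqrt_bound], applied with [512] and with [K]. *)
exists (/ INR 513)%R, (INR K.+1).
have p513 : (0 < INR 513)%R by apply: lt_0_INR; apply/ssrnat.ltP.
split; first exact: Rinv_0_lt_compat.
split; first by apply: lt_0_INR; apply/ssrnat.ltP.
exists 8 => n n8; have n0 : (0 < n)%N by apply: leq_trans n8.
have powE := @Rpower_three_halves_sq n n0.
have pow0 : (0 <= Rpower (INR n) (3 / 2))%R by apply: Rlt_le; apply: exp_pos.
have ex0 := pos_INR (ex (@prism_adj l) n).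
have sqE m : INR (expn m 2) = (INR m * INR m)%R by rewrite -mulnn mult_INR.
split.
  apply: (Rmult_le_reg_l (INR 513)) => //.
  rewrite -Rmult_assoc Rinv_r ?Rmult_1_l; last by Lra.lra.
  apply: sqrt_bound => //; rewrite powE -sqE -mult_INR; apply: le_INR; apply/ssrnat.leP.
  by apply: many_prism_free_edges => //; apply: leq_trans l4.
apply: sqrt_bound => //; rewrite powE -sqE -mult_INR; apply: le_INR; apply/ssrnat.leP.
rewrite /ex; elim/big_ind: _ => [|x y Hx Hy|E /andP[]]; last exact: upper.
  by [].
by rewrite /maxn; case: ifP.
Qed.
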